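(* Let $\Omega\subset\mathbb{R}^N$ be an open, bounded, connected set. Let $1<p<\infty$, $0<s<1$ and $1<q\le p$. Let \[ \lambda^s_{p,q}(\Omega)=\min_{w\in W^{s,p}_0(\Omega)}\left\{\|w\|^p_{W^{s,p}_0(\Omega)}\, :\, \|w\|_{L^q(\Omega)}=1\right\}. \] Let $\lambda>0$ be such that there exists a nontrivial function $u\in W^{s,p}_0(\Omega)$ with $u\ge 0$ in $\Omega$ which is a weak solution of \[ (-\Delta_p)^s u=\lambda\, |u|^{q-2}\, u\quad \text{in }\Omega. \] Then \[ \lambda\, \left(\int_\Omega |u|^q\, dx\right)^\frac{q-p}{q}=\lambda^s_{p,q}(\Omega), \] and $v=u\,\|u\|_{L^q(\Omega)}^{-1}$ is a minimizer of the variational problem defining $\lambda^s_{p,q}(\Omega)$.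
   Context: $W^{s,p}_0(\Omega)$ denotes the completion of $C^\infty_0(\Omega)$ (functions extended by $0$ to $\mathbb{R}^N$) with respect to the norm \[ \|u\|_{W^{s,p}_0(\Omega)}=\left(\int_{\mathbb{R}^N}\int_{\mathbb{R}^N} \frac{|u(x)-u(y)|^{p}}{|x-y|^{N+s\,p}}\, dx\, dy\right)^\frac{1}{p}; \] its elements are regarded as functions on $\mathbb{R}^N$ vanishing outside $\Omega$. A function $u\in W^{s,p}_0(\Omega)$ is a weak solution of $(-\Delta_p)^su=\lambda|u|^{q-2}u$ in $\Omega$ if \[ \int_{\mathbb{R}^N}\int_{\mathbb{R}^N} \frac{|u(x)-u(y)|^{p-2}\, \big(u(x)-u(y)\big)}{|x-y|^{N+s\,p}}\, \big(\varphi(x)-\varphi(y)\big)\, dx\, dy=\lambda\, \int_\Omega |u|^{q-2}\, u\, \varphi\, dx \] for every $\varphi\in W^{s,p}_0(\Omega)$. The expression $|a|^{r-2}a$ is understood to be $0$ for $a=0$. *)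

(* Defs.v *)
From HB Require Import structures.
From mathcomp Require Import all_boot all_order all_algebra.
From mathcomp Require Import all_classical all_reals all_analysis.

Set Implicit Arguments.
Unset Strict Implicit.
Unset Printing Implicit Defensive.

Import Order.TTheory GRing.Theory Num.Theory.
Import numFieldNormedType.Exports.

Local Open Scope classical_set_scope.
Local Open Scope ring_scope.

(** R^n is 'rV[R]_n, with the sigma-algebra generated by the coordinates (i.e.
    the Borel sigma-algebra), as MathComp-Analysis does for n.-tuple. *)
Definition rV_display : measure_display -> measure_display.
Proof. exact. Qed.

Section measurable_rV.
Context {R : realType}.
Variable n : nat.

Let coord : 'I_n -> 'rV[R]_n -> R := fun i x => x ord0 i.

Let rV_set0 : g_sigma_preimage coord set0.
Proof. exact: sigma_algebra0. Qed.

Let rV_setC A : g_sigma_preimage coord A -> g_sigma_preimage coord (~` A).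
Proof. exact: sigma_algebraC. Qed.

Let rV_bigcup (F : _^nat) : (forall i, g_sigma_preimage coord (F i)) ->
  g_sigma_preimage coord (\bigcup_i (F i)).
Proof. exact: sigma_algebra_bigcup. Qed.

HB.instance Definition _ := @isMeasurable.Build (rV_display default_measure_display)
  'rV[R]_n (g_sigma_preimage coord) rV_set0 rV_setC rV_bigcup.

End measurable_rV.

Lemma measurable_rV_coord {R : realType} n (i : 'I_n) :
  measurable_fun [set: 'rV[R]_n] (fun x : 'rV[R]_n => x ord0 i).
Proof.
move=> _ Y mY; rewrite setTI; apply: sub_sigma_algebra => /=.
rewrite -bigcup_seq/=; exists i => /=; first by rewrite mem_index_enum.
by exists Y => //; rewrite setTI.
Qed.

Lemma measurable_fun_rVP {R : realType} d (T : measurableType d) n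
    (f : T -> 'rV[R]_n) :
  (forall i, measurable_fun [set: T] (fun x => f x ord0 i)) ->
  measurable_fun [set: T] f.
Proof.
move=> mf.
have fE : g_sigma_preimage (fun i => (fun x : 'rV[R]_n => x ord0 i) \o f) =
  preimage_set_system [set: T] f
    (g_sigma_preimage (fun (i : 'I_n) (x : 'rV[R]_n) => x ord0 i)).
  by rewrite g_sigma_preimage_comp.
move=> _ A mA; have : g_sigma_preimage
    (fun i => (fun x : 'rV[R]_n => x ord0 i) \o f) (setT `&` f @^-1` A).
  by rewrite fE; exists A.
apply: smallest_sub; first exact: sigma_algebra_measurable.
rewrite -bigcup_seq => B [i /= _ [C mC <-]]; exact: mf.
Qed.

(** Lebesgue measure on R^n, as the n-fold product of [lebesgue_measure]. *)
Section lebesgue_measure_rV.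
Context {R : realType}.

Definition rV_cons n (p : R * 'rV[R]_n) : 'rV[R]_n.+1 :=
  \row_i (if unlift ord0 i is Some j then p.2 ord0 j else p.1).

Definition rV_uncons n (x : 'rV[R]_n.+1) : R * 'rV[R]_n :=
  (x ord0 ord0, \row_j x ord0 (lift ord0 j)).

Lemma rV_consK n : cancel (@rV_cons n) (@rV_uncons n).
Proof.
case=> a v; rewrite /rV_cons /rV_uncons mxE unlift_none; congr pair => /=.
by apply/rowP => j; rewrite !mxE liftK.
Qed.

Lemma measurable_rV_cons n : measurable_fun setT (@rV_cons n).
Proof.
apply: measurable_fun_rVP => i; case: (unliftP ord0 i) => [j ->|->].
  rewrite (_ : (fun _ => _) = (fun x : 'rV[R]_n => x ord0 j) \o snd).
    by apply: measurableT_comp; [exact: measurable_rV_coord|exact: measurable_snd].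
  by apply/funext => p; rewrite mxE liftK.
rewrite (_ : (fun _ => _) = fst); first exact: measurable_fst.
by apply/funext => p; rewrite mxE unlift_none.
Qed.

Lemma measurable_rV_uncons n : measurable_fun setT (@rV_uncons n).
Proof.
apply: measurable_fun_pair; first exact: measurable_rV_coord.
apply: measurable_fun_rVP => i.
rewrite (_ : (fun _ => _) = (fun x : 'rV[R]_n.+1 => x ord0 (lift ord0 i))).
  exact: measurable_rV_coord.
by apply/funext => x; rewrite mxE.
Qed.

Section step.
Variables (n : nat) (m : {sigma_finite_measure set 'rV[R]_n -> \bar R}).

Definition lebesgue_rV_step : set 'rV[R]_n.+1 -> \bar R :=
  pushforward (lebesgue_measure \x m)%E (@rV_cons n).

Let step0 : lebesgue_rV_step set0 = 0%E.
Proof. by rewrite /lebesgue_rV_step /pushforward preimage_set0 measure0. Qed.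

Let step_ge0 A : (0 <= lebesgue_rV_step A)%E.
Proof. by rewrite /lebesgue_rV_step /pushforward measure_ge0. Qed.

Let step_sigma_additive : semi_sigma_additive lebesgue_rV_step.
Proof.
have mK A : measurable A -> measurable (@rV_cons n @^-1` A).
  by move=> mA; rewrite -[X in measurable X]setTI; exact: measurable_rV_cons.
move=> F mF tF mUF; rewrite /lebesgue_rV_step /pushforward preimage_bigcup.
apply: measure_semi_sigma_additive.
- by move=> k; exact: mK.
- apply/trivIsetP => /= i j _ _ ij; rewrite -preimage_setI.
  by move/trivIsetP : tF => /(_ _ _ _ _ ij) ->//; rewrite preimage_set0.
- by rewrite -preimage_bigcup; exact: mK.
Qed.

HB.instance Definition _ := isMeasure.Build _ _ _
  lebesgue_rV_step step0 step_ge0 step_sigma_additive.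

Let step_sigma_finite : sigma_finite setT lebesgue_rV_step.
Proof.
have /sigma_finiteP[F [TF ndF Foo]] :=
  sigma_finiteT (@lebesgue_measure R : {sigma_finite_measure set _ -> \bar R}).
have /sigma_finiteP[G [TG ndG Goo]] := sigma_finiteT m.
exists (fun k => @rV_uncons n @^-1` (F k `*` G k)).
  rewrite -preimage_bigcup -(preimage_setT (@rV_uncons n)); congr (_ @^-1` _).
  rewrite -setXTT TF TG predeqE => -[x y]; split.
    move=> [/= [a _ Fax] [b _ Gby]]; exists (maxn a b) => //; split.
    - by move: x Fax; exact/subsetPset/ndF/leq_maxl.
    - by move: y Gby; exact/subsetPset/ndG/leq_maxr.
  by move=> [a _ []/= ? ?]; split; exists a.
move=> k; have [mF Fk] := Foo k; have [mG Gk] := Goo k.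
split; first by rewrite -[X in measurable X]setTI;
  apply: measurable_rV_uncons => //; exact: measurableX.
rewrite /lebesgue_rV_step /pushforward -comp_preimage.
rewrite (_ : _ \o _ = id) ?preimage_id; last exact/funext/rV_consK.
by rewrite product_measure1E// lte_mul_pinfty// ge0_fin_numE.
Qed.

HB.instance Definition _ := Measure_isSigmaFinite.Build _ _ _
  lebesgue_rV_step step_sigma_finite.
End step.

Fixpoint lebesgue_measure_rV n : {sigma_finite_measure set 'rV[R]_n -> \bar R} :=
  match n with
  | 0 => dirac (0 : 'rV[R]_0)
  | n'.+1 => lebesgue_rV_step (lebesgue_measure_rV n')
  end.

End lebesgue_measure_rV.

Section box.
Context {R : realType}.

Lemma lebesgue_measure_rV_box n (A : 'I_n -> set R) :
  (forall i, measurable (A i)) ->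
  lebesgue_measure_rV n [set x | forall i, A i (x ord0 i)] =
  (\prod_(i < n) lebesgue_measure (A i))%E.
Proof.
elim: n A => [|n IH] A mA.
  rewrite big_ord0 /= diracE mem_set//= => -[].
  by [].
rewrite big_ord_recl -(IH (fun i => A (lift ord0 i)))//=.
have mB : measurable [set x : 'rV[R]_n | forall i, A (lift ord0 i) (x ord0 i)].
  rewrite (_ : [set _ | _] = \bigcap_(i in [set: 'I_n])
      (fun x : 'rV[R]_n => x ord0 i) @^-1` A (lift ord0 i)).
    apply: fin_bigcap_measurable => // i _; rewrite -[X in measurable X]setTI.
    exact: measurable_rV_coord.
  by apply/seteqP; split => [x Ax i _|x Ax i]; [exact: Ax|exact: (Ax i I)].
rewrite /lebesgue_rV_step /pushforward -product_measure1E//; last exact: mA.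
congr ((_ \x _)%E _).
apply/seteqP; split => [[a v] /= Aav|[a v] /= [Aa Av] i].
  split=> [|i]; first by have := Aav ord0; rewrite mxE unlift_none.
  by have := Aav (lift ord0 i); rewrite mxE liftK.
by rewrite mxE; case: unliftP => [j ->|->].
Qed.
End box.

Section fractional_sobolev.
Context {R : realType} {N : nat}.
Implicit Types (Omega : set 'rV[R]_N) (u v phi : 'rV[R]_N -> R) (p q s : R).

Local Notation leb := (lebesgue_measure_rV N).

(** The library's norm on 'rV[R]_N is the sup norm; the kernel needs the
    Euclidean one. *)
Definition enorm (x : 'rV[R]_N) : R := Num.sqrt (\sum_i x ord0 i ^+ 2).

Fixpoint class_C (k : nat) (f : 'rV[R]_N -> R) : Prop :=
  match k with
  | 0 => continuous f
  | k'.+1 => continuous f /\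
      forall i : 'I_N, (forall x, derivable f x (delta_mx ord0 i)) /\
        class_C k' (fun x => 'D_(delta_mx ord0 i) f x)
  end.

(** C^\infty_0(Omega): smooth on R^N, with compact support contained in Omega. *)
Definition test_function Omega phi : Prop :=
  [/\ forall k, class_C k phi,
      compact (closure [set x | phi x != 0])
    & closure [set x | phi x != 0] `<=` Omega].

(** The norm of W^{s,p}_0, on measurable functions (possibly infinite). On the
    diagonal the kernel has the value 0, which is irrelevant when 0 < N. *)
Definition Wnorm s p u : \bar R :=
  ((\int[leb \x leb]_z
     (`|u z.1 - u z.2| `^ p / enorm (z.1 - z.2) `^ (N%:R + s * p))%:E)
   `^ p^-1)%E.

(** The completion of C^\infty_0(Omega) for [Wnorm s p], realised as the
    functions vanishing a.e. outside Omega which are limits of test functions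
    for [Wnorm s p]. For bounded Omega and 0 < N this is the abstract
    completion, by the Poincare inequality and Fatou's lemma, once functions
    are taken up to a.e. equality: Wnorm determines a function up to an
    additive constant, and the vanishing outside Omega fixes the constant. *)
Definition W0 s p Omega u : Prop :=
  [/\ measurable_fun setT u,
      {ae leb, forall x, ~ Omega x -> u x = 0}
    & exists phi : nat -> 'rV[R]_N -> R,
        (forall k, test_function Omega (phi k)) /\
        Wnorm s p (fun x => phi k x - u x) @[k --> \oo] --> 0%E].

(** |a|^{r-2} a, which is 0 at a = 0 whatever the value of 0 `^ (r - 2). *)
Definition spow (r a : R) : R := `|a| `^ (r - 2) * a.

Definition weak_solution s p q Omega (lambda : R) u : Prop :=
  W0 s p Omega u /\
  forall phi, W0 s p Omega phi ->
    (\int[leb \x leb]_z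
       (spow p (u z.1 - u z.2) / enorm (z.1 - z.2) `^ (N%:R + s * p)
        * (phi z.1 - phi z.2))%:E
     = lambda%:E * \int[leb]_(x in Omega) (spow q (u x) * phi x)%:E)%E.

Definition Lqnorm q Omega u : \bar R := 'N[leb]_q%:E [EFin \o (u \_ Omega)].

Definition admissible s p q Omega w : Prop :=
  W0 s p Omega w /\ Lqnorm q Omega w = 1%E.

Definition lambda_spq s p q Omega : \bar R :=
  ereal_inf [set (Wnorm s p w `^ p)%E | w in admissible s p q Omega].

Definition is_minimizer s p q Omega v : Prop :=
  admissible s p q Omega v /\ (Wnorm s p v `^ p)%E = lambda_spq s p q Omega.

End fractional_sobolev.

(* Main.v *)
Require Import Defs.
From HB Require Import structures.
From mathcomp Require Import all_boot all_order all_algebra.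
From mathcomp Require Import all_classical all_reals all_analysis.
From mathcomp Require Import measurable_realfun ring lra.
Set Implicit Arguments.
Unset Strict Implicit.
Unset Printing Implicit Defensive.
Import Order.TTheory GRing.Theory Num.Theory.
Import numFieldNormedType.Exports.
Local Open Scope classical_set_scope.
Local Open Scope ring_scope.

(** For a weak solution [u >= 0] and a test function [w], the function
    [phi = |w|^q (|u| + c)^(1 - q)] is admissible in the weak equation, and
    Picone's inequality followed by Young's bounds the left-hand integrand by
    [(q/p) |w(x) - w(y)|^p K + (1 - q/p) |u(x) - u(y)|^p K], uniformly in [c > 0].
    Letting [c] tend to 0 has two effects. On pairs with [u(x) = 0 < u(y)] and
    [w(x) <> 0] the integrand tends to [-oo], so such pairs form a null set; this
    replaces the strong minimum principle. The right-hand side then converges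
    to [lambda \int |w|^q], whence
    [lambda \int |w|^q <= (q/p) E(w) + (1 - q/p) E(u)], where [E] is the p-th
    power of the norm. This extends to all [w] in the space by density. Taking
    [w] with the same L^q norm as [u], and using [E(u) = lambda \int u^q], gives
    [E(u) <= E(w)]. *)

(** * Measurability in 'rV[R]_n *)

(** The obstacle is to show that [phi] belongs to the space. Elements of [W0] are known only as norm
    limits of test functions, and the norm sees only differences [u(x) - u(y)]. A subsequence with
    summable errors gives a.e. convergence of differences together with an integrable majorant;
    comparison with a point outside [Omega], where everything vanishes, upgrades this to a.e.
    convergence of the functions themselves, which the nonlinear [phi] requires. Taking [w] to be a
    test function keeps [|w|] bounded, so [|w|^q] is Lipschitz in [w], while the shift [c] keeps the
    base of the negative power [1 - q] away from 0. A null set of pairs is enough to replace a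
    minimum principle because the equation is nonlocal: a zero [x] of [u] is coupled with every [y].
    If [w] were nonzero on a non-null set of zeros of [u], then [u] would vanish almost everywhere.
    The weights [q/p] and [1 - q/p] from Young's inequality cost nothing at the end: when the L^q
    norms of [w] and [u] agree, the term [(1 - q/p) E(u)] cancels against the same multiple of
    [lambda \int u^q]. *)

Lemma measurable_row_cube (R : realType) n (k : nat) (z : 'rV[int]_n) :
  measurable [set x : 'rV[R]_n | forall i, Num.floor (k.+1%:R * x ord0 i) = z ord0 i].
Proof.
rewrite (_ : [set _ | _] = \bigcap_(i in [set: 'I_n])
    (fun x : 'rV[R]_n => x ord0 i) @^-1`
    [set t | Num.floor (k.+1%:R * t) = z ord0 i]); last first.
  by apply/seteqP; split => [x Ax i _|x Ax i]; [exact: Ax|exact: (Ax i I)].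
apply: fin_bigcap_measurable => // i _.
rewrite -[X in measurable X]setTI; apply: measurable_rV_coord => //.
rewrite (_ : [set _ | _] =
  `[(z ord0 i)%:~R / k.+1%:R, (z ord0 i + 1)%:~R / k.+1%:R[%classic).
  exact: measurable_itv.
apply/seteqP; split => t /=; rewrite in_itv/= ler_pdivrMr// ltr_pdivlMr// mulrC.
  by move/eqP; rewrite floor_eq mulrC.
by move=> h; apply/eqP; rewrite floor_eq.
Qed.

(** The sigma-algebra is generated by the coordinates, so [A] has to be exhausted by countably many
    boxes: the grid cubes of side [1/(k+1)] contained in [A] cover it, since in the sup norm a small
    cube through a point stays in any given ball around it. *)
Lemma open_measurable_row (R : realType) n (A : set 'rV[R]_n) :
  open A -> measurable A.
Proof.
move=> oA.
pose cube (kz : nat * 'rV[int]_n) := [set x : 'rV[R]_n |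
  forall i, Num.floor (kz.1.+1%:R * x ord0 i) = kz.2 ord0 i].
rewrite (_ : A = \bigcup_kz (if `[< cube kz `<=` A >] then cube kz else set0)).
  apply: (@countable_bigcupT_measurable _ _ (nat * 'rV[int]_n)%type); first exact: countableP.
  move=> [k z].
  by case: ifPn => // _; exact: measurable_row_cube.
apply/seteqP; split => [x Ax|x [kz _]]; last by case: asboolP => // kzA /kzA.
have /nbhs_ballP[e /= e0 eA] : nbhs x A by exact: open_nbhs_nbhs.
have [k ke] : exists k : nat, k.+1%:R^-1 < e.
  exists (Num.bound e^-1); rewrite invf_plt ?posrE//.
  by rewrite (lt_le_trans (archi_boundP _))// ?ler_nat// invr_ge0 ltW.
exists (k, \row_i Num.floor (k.+1%:R * x ord0 i)) => //.
case: asboolP => [_ i|]; first by rewrite mxE.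
move=> nA; exfalso; apply: nA => y /= xy; apply: eA; split => // i j; rewrite (ord1 i).
have := xy j; rewrite mxE => {}xy.
rewrite /ball/=.
have := floor_itv (k.+1%:R * y ord0 j); have := floor_itv (k.+1%:R * x ord0 j).
rewrite xy intrD1 => /andP[h1 h2] /andP[h3 h4].
apply: lt_trans ke; rewrite -(ltr_pM2l (ltr0Sn R k)) divff ?pnatr_eq0//.
rewrite -[X in X * _]gtr0_norm// -normrM mulrBr ltr_norml; apply/andP; split.
  by rewrite ltrBrDr addrC ltrBlDr; apply: (lt_le_trans h4); rewrite lerD2r.
by rewrite ltrBlDr addrC; apply: (lt_le_trans h2); rewrite lerD2r.
Qed.

Lemma continuous_measurable_row (R : realType) n (f : 'rV[R]_n -> R) :
  continuous f -> measurable_fun setT f.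
Proof.
move=> /continuousP cf; apply: (measurability _ (RGenOpens.measurableE R)).
by move=> _ [_ [a [b ->] <-]]; rewrite setTI; apply: open_measurable_row; apply: cf; exact: interval_open.
Qed.

Lemma measurable_row_sub (R : realType) n :
  measurable_fun setT (fun z : 'rV[R]_n * 'rV[R]_n => z.1 - z.2).
Proof.
apply: measurable_fun_rVP => i; rewrite (_ : (fun _ => _) =
    (fun z : 'rV[R]_n * 'rV[R]_n => z.1 ord0 i) \- (fun z => z.2 ord0 i)).
  apply: measurable_funB.
    exact: (measurableT_comp (measurable_rV_coord i) measurable_fst).
  exact: (measurableT_comp (measurable_rV_coord i) measurable_snd).
by apply/funext => z; rewrite !mxE.
Qed.

Lemma measurable_norm_powR d (T : measurableType d) (R : realType) (D : set T)
    (f : T -> R) r :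
  measurable_fun D f -> measurable_fun D (fun x => `|f x| `^ r).
Proof.
move=> mf; apply: (measurableT_comp (measurable_powR _)).
exact: (measurableT_comp (@normr_measurable _ _)).
Qed.

(** * Null sets of product measures *)

Section ae_product.
Context d1 d2 (T1 : measurableType d1) (T2 : measurableType d2) (R : realType).
Variables (m1 : {sigma_finite_measure set T1 -> \bar R})
  (m2 : {sigma_finite_measure set T2 -> \bar R}).

(** By Tonelli the measure of an exceptional set is the integral of the measures of its sections, so
    almost all sections of a null set are null. *)
Lemma ae_xsection (P : T1 * T2 -> Prop) :
  {ae (m1 \x m2)%E, forall z, P z} ->
  {ae m1, forall x, {ae m2, forall y, P (x, y)}}.
Proof.
move=> [A [mA A0 sA]].
have mf := measurable_fun_xsection m2 mA.
have : (\int[m1]_(x in setT) `|(m2 \o xsection A) x| = 0)%E.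
  rewrite -A0; apply: eq_integral => x _; rewrite gee0_abs//.
move/(ae_eq_integral_abs _ measurableT mf); apply: filterS => x /= /(_ I) x0.
exists (xsection A x); split => //; first exact: measurable_xsection.
by move=> y /= nP; rewrite /xsection/= inE; exact: sA.
Qed.

Lemma ae_prod_fst (P : T1 -> Prop) :
  {ae m1, forall x, P x} -> {ae (m1 \x m2)%E, forall z, P z.1}.
Proof.
move=> [A [mA A0 sA]]; exists (A `*` setT); split; first exact: measurableX.
  by transitivity (m1 A * m2 setT)%E; [exact: product_measure1E|rewrite A0 mul0e].
by move=> z /= nP; split => //; exact: sA.
Qed.

Lemma ae_prod_snd (P : T2 -> Prop) :
  {ae m2, forall x, P x} -> {ae (m1 \x m2)%E, forall z, P z.2}.
Proof.
move=> [A [mA A0 sA]]; exists (setT `*` A); split; first exact: measurableX.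
  by transitivity (m1 setT * m2 A)%E; [exact: product_measure1E|rewrite A0 mule0].
by move=> z /= nP; split => //; exact: sA.
Qed.

End ae_product.

(** * Pointwise inequalities *)

Section pointwise_inequalities.
Context {R : realType}.
Implicit Types a b c d p q t x y : R.

Lemma powRD_gt0 t a b : 0 < t -> t `^ (a + b) = t `^ a * t `^ b.
Proof. by move=> t0; rewrite powRD// (gt_eqF t0) implybT. Qed.

(** Convexity of the [q]-th power at the points [x / (1 - t)] and [y / t], with weights [1 - t] and
    [t]. *)
Lemma powR_convex_split q t x y : 1 <= q -> 0 < t < 1 -> 0 <= x -> 0 <= y ->
  (x + y) `^ q <= (1 - t) `^ (1 - q) * x `^ q + t `^ (1 - q) * y `^ q.
Proof.
move=> q1 /andP[t0 t1] x0 y0.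
have t1' : 0 < 1 - t by rewrite subr_gt0.
have ti : 0 <= 1 - t <= 1 by apply/andP; split; lra.
have := @convex_powR R q q1 (Itv01 (andP ti).1 (andP ti).2) (x / (1 - t)) (y / t).
rewrite !inE/= !in_itv/= !andbT !divr_ge0 ?(ltW t0) ?(ltW t1')// => /(_ isT isT).
rewrite [X in _ <= X -> _]convRE/=.
have onemt : unstable.onem (1 - t) = t by rewrite /unstable.onem; ring.
set w := conv _ _ _; have -> : w = (1 - t) * (x / (1 - t)) + t * (y / t).
  by rewrite /w [LHS]convRE/= onemt.
rewrite onemt.
rewrite mulrCA divff ?gt_eqF// mulr1 mulrCA divff ?gt_eqF// mulr1.
move=> /le_trans; apply.
have aux s z : 0 < s -> 0 <= z -> s * (z / s) `^ q = s `^ (1 - q) * z `^ q.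
  move=> s0 z0; rewrite powRM// ?invr_ge0 ?ltW// -powR_inv1 ?ltW// -powRrM mulN1r.
  by rewrite powRD_gt0// powRr1 ?ltW//; ring.
by rewrite !aux.
Qed.

(** The choice [t = d / c] in [powR_convex_split], applied to [a <= |a - b| + b], makes [1 - t]
    equal to [(c - d) / c]; multiplying by [(c - d)^(q - 1) * c^(1 - q)] then leaves the coefficient
    1 in front of [|a - b|^q]. *)
Lemma picone_ordered q a b c d : 1 <= q -> 0 <= a -> 0 <= b -> 0 < d -> d < c ->
  (c - d) `^ (q - 1) * (a `^ q * c `^ (1 - q) - b `^ q * d `^ (1 - q)) <=
  `|a - b| `^ q.
Proof.
move=> q1 a0 b0 d0 dc; have c0 := lt_trans d0 dc.
have cd : 0 < c - d by rewrite subr_gt0.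
have t01 : 0 < d / c < 1 by rewrite divr_gt0//= ltr_pdivrMr// mul1r.
have := powR_convex_split q1 t01 (normr_ge0 (a - b)) b0.
have E1 : 1 - d / c = (c - d) / c by rewrite mulrBl divff// gt_eqF.
have divE x y r : 0 < x -> 0 < y -> (x / y) `^ r = x `^ r * y `^ (- r).
  by move=> x0 y0; rewrite powRM ?invr_ge0 ?ltW// -powR_inv1 ?ltW// -powRrM mulN1r.
rewrite E1 !divE// !opprB.
have abq : a `^ q <= (`|a - b| + b) `^ q.
  rewrite ge0_ler_powR ?nnegrE ?addr_ge0//; first lra.
  by rewrite -lerBlDr ler_norm.
move=> /(le_trans abq){abq}.
have k0 : 0 < (c - d) `^ (q - 1) * c `^ (1 - q) by rewrite mulr_gt0// powR_gt0.
rewrite -(ler_pM2l k0).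
have e1 : (c - d) `^ (1 - q) * (c - d) `^ (q - 1) = 1.
  by rewrite -powRD_gt0// (_ : 1 - q + (q - 1) = 0) ?powRr0//; ring.
have e2 : c `^ (1 - q) * c `^ (q - 1) = 1.
  by rewrite -powRD_gt0// (_ : 1 - q + (q - 1) = 0) ?powRr0//; ring.
set A := a `^ q; set D := `|a - b| `^ q; set B := b `^ q.
move: e1 e2; set u1 := (c - d) `^ (1 - q); set u2 := (c - d) `^ (q - 1).
set v1 := c `^ (1 - q); set v2 := c `^ (q - 1); set w := d `^ (1 - q) => e1 e2.

have -> : u2 * v1 * (u1 * v2 * D + w * v2 * B) =
  (u1 * u2) * (v1 * v2) * D + u2 * w * (v1 * v2) * B by ring.
rewrite e1 e2 !mul1r mulr1 => h.
have -> : u2 * (A * v1 - B * w) = u2 * v1 * A - u2 * w * B by ring.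
by rewrite lerBlDr.
Qed.

(** Young's inequality with the conjugate exponents [p / q] and [p / (p - q)]. For [q = p] the
    second exponent degenerates and the two sides coincide, so this case is treated apart. *)
Lemma young_powR p q x y : 1 < q <= p -> 0 <= x -> 0 < y ->
  x `^ q * y `^ (p - q) <= q / p * x `^ p + (1 - q / p) * y `^ p.
Proof.
move=> /andP[q1 qp] x0 y0; have q0 : 0 < q by lra.
have p0 : 0 < p by lra.
move: qp; rewrite le_eqVlt => /orP[/eqP <-|qp].
  by rewrite subrr powRr0 divff ?gt_eqF//; lra.
have pq0 : 0 < p - q by lra.
have := @conjugate_powR R (x `^ q) (y `^ (p - q)) (p / q) (p / (p - q))
  (powR_ge0 _ _) (powR_ge0 _ _).
rewrite !divr_gt0// !invf_div => /(_ isT isT).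
have -> : q / p + (p - q) / p = 1 by field; rewrite gt_eqF.
move=> /(_ erefl) /le_trans; apply.
rewrite -!powRrM !(mulrC _ (p / _)) !divfK ?gt_eqF// mulrC.
by rewrite [X in _ + X]mulrC (_ : (p - q) / p = 1 - q / p)//; field; rewrite gt_eqF.
Qed.

Lemma spow_gt0 p x : 0 < x -> spow p x = x `^ (p - 1).
Proof.
move=> x0; rewrite /spow gtr0_norm// -[X in _ * X]powRr1 ?ltW//.
by rewrite -powRD_gt0//; congr (_ `^ _); ring.
Qed.

Lemma spowN p x : spow p (- x) = - spow p x.
Proof. by rewrite /spow normrN mulrN. Qed.

Lemma spow0 p : spow p (0 : R) = 0.
Proof. by rewrite /spow mulr0. Qed.

Lemma spow_mul p x : p != 0 -> spow p x * x = `|x| `^ p.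
Proof.
move=> p0; rewrite /spow -mulrA -expr2 -real_normK ?num_real//.
have [->|x0] := eqVneq `|x| 0; first by rewrite expr0n mulr0 powR0.
rewrite -powR_mulrn ?normr_ge0// -powRD ?x0 ?implybT//.
by congr (_ `^ _); ring.
Qed.

(* Picone's inequality for exponents [q <= p], followed by Young's inequality
   to separate the two differences. *)
Lemma picone p q a b c d : 1 < q <= p -> 0 <= a -> 0 <= b -> 0 < c -> 0 < d ->
  spow p (c - d) * (a `^ q * c `^ (1 - q) - b `^ q * d `^ (1 - q)) <=
  q / p * `|a - b| `^ p + (1 - q / p) * `|c - d| `^ p.
Proof.
move=> qp; move: (qp) => /andP[q1 q_p].
have p0 : 0 < p by lra.
have main a' b' c' d' : 0 <= a' -> 0 <= b' -> 0 < d' -> d' < c' ->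
    spow p (c' - d') * (a' `^ q * c' `^ (1 - q) - b' `^ q * d' `^ (1 - q)) <=
    q / p * `|a' - b'| `^ p + (1 - q / p) * `|c' - d'| `^ p.
  move=> a0 b0 d0 dc; have cd : 0 < c' - d' by rewrite subr_gt0.
  rewrite spow_gt0// (gtr0_norm cd).
  apply: le_trans (young_powR qp (normr_ge0 _) cd).
  (* The factor with exponent [p - q] is the one Young's inequality pairs with [|a' - b'|^q]; the
     factor with exponent [q - 1] is the weight in [picone_ordered]. *)
  rewrite (_ : p - 1 = (p - q) + (q - 1)); last by ring.
  rewrite powRD_gt0// -mulrA [leRHS]mulrC ler_pM2l ?powR_gt0//.
  by apply: picone_ordered => //; exact: ltW.
move=> a0 b0 c0 d0; have [dc|cd|->] := ltgtP d c.
- exact: main.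
- have := main _ _ _ _ b0 a0 c0 cd.
  by rewrite (distrC b a) (distrC d c) -(opprB c d) spowN mulNr -mulrN opprB.
- rewrite subrr spow0 mul0r addr_ge0// mulr_ge0 ?powR_ge0//.
    by rewrite divr_ge0//; lra.
  by rewrite subr_ge0 ler_pdivrMr// mul1r.
Qed.

End pointwise_inequalities.

(** * Smooth functions *)

Section directional_derivatives.
Context {R : realType} {V : normedModType R}.
Implicit Types (f : V -> R) (v x : V).

Lemma is_derive_line f v x l :
  is_derive x v f l <-> is_derive (0 : R) 1 (fun h : R => f (h *: v + x)) l.
Proof.
have E : 'D_v f x = 'D_1 (fun h : R => f (h *: v + x)) 0.
  rewrite /derive; set g1 := fun h => h^-1 *: _; set g2 := fun h => h^-1 *: _.
  suff -> : g1 = g2 by [].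
  by rewrite funeqE /g1 /g2 => h /=; rewrite addr0 scale0r add0r [_%:A]mulr1.
split => -[df <-]; first by split; [exact: (derivable1P f x v).1|rewrite E].
by split; [exact: (derivable1P f x v).2|rewrite E].
Qed.

Lemma is_derive_line_at f v x (t : R) l : is_derive (t *: v + x) v f l ->
  is_derive t 1 (fun h : R => f (h *: v + x)) l.
Proof.
move=> /is_derive_line df.
have -> : (fun h : R => f (h *: v + x)) =
    (fun h => f (h *: v + (t *: v + x))) \o (fun h => h - t).
  by apply/funext => h /=; rewrite addrA -scalerDl subrK.
rewrite -[l]mulr1; apply: is_derive1_comp; first by rewrite subrr.
by rewrite -[X in is_derive _ _ _ X]subr0; apply: is_deriveB.
Qed.

Lemma is_derive_powR f v x l r : 0 < f x -> is_derive x v f l ->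
  is_derive x v (fun y => f y `^ r) (r * f x `^ (r - 1) * l).
Proof.
move=> f0 /is_derive_line df; apply/is_derive_line.
apply: (@is_derive1_comp _ (fun y => y `^ r) (fun h : R => f (h *: v + x))) => //.
by rewrite scale0r add0r; exact: is_derive1_powR.
Qed.

End directional_derivatives.

Lemma continuous_powR_gt0 (R : realType) (T : topologicalType) (f : T -> R) r :
  (forall x, 0 < f x) -> continuous f -> continuous (fun x => f x `^ r).
Proof.
move=> f0 cf x; apply: (@continuous_comp _ _ _ f (fun y => y `^ r)); first exact: cf.
apply: differentiable_continuous; apply/derivable1_diffP.
by have [] := @is_derive1_powR R r _ (f0 x).
Qed.

Section smooth_functions.
Context {R : realType} {N : nat}.
Implicit Types (f g : 'rV[R]_N -> R) (k : nat).

Lemma eq_class_C k f g : f =1 g -> class_C k g -> class_C k f.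
Proof. by move=> /funext ->. Qed.

Lemma class_CW k f : class_C k.+1 f -> class_C k f.
Proof.
elim: k f => [|k IH] f; first by case.
case=> cf df; split => // i; have [dfi Cfi] := df i; split => //; exact: IH.
Qed.

Lemma class_C_cst k (c : R) : class_C k (fun _ : 'rV[R]_N => c).
Proof.
elim: k c => [|k IH] c; first exact: cst_continuous.
split; first exact: cst_continuous.
move=> i; split => [x|]; first exact: derivable_cst.
by apply: (eq_class_C _ (IH 0)) => x; exact: derive_cst.
Qed.

Lemma class_CD k f g : class_C k f -> class_C k g ->
  class_C k (fun x => f x + g x).
Proof.
elim: k f g => [|k IH] f g.
  by move=> cf cg x; exact: (continuousD (cf x) (cg x)).
case=> cf df [cg dg]; split.
  by move=> x; exact: (continuousD (cf x) (cg x)).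
move=> i; have [dfi Cfi] := df i; have [dgi Cgi] := dg i; split.
  by move=> x; apply: derivableD.
apply: (eq_class_C _ (IH _ _ Cfi Cgi)) => x.
by rewrite -(deriveD (dfi x) (dgi x)).
Qed.

Lemma class_CM k f g : class_C k f -> class_C k g ->
  class_C k (fun x => f x * g x).
Proof.
elim: k f g => [|k IH] f g.
  by move=> cf cg x; exact: (continuousM (cf x) (cg x)).
move=> Cf Cg; have [cf df] := Cf; have [cg dg] := Cg; split.
  by move=> x; exact: (continuousM (cf x) (cg x)).
move=> i; have [dfi Cfi] := df i; have [dgi Cgi] := dg i; split.
  by move=> x; apply: derivableM.
have C1 := IH _ _ (class_CW Cf) Cgi; have C2 := IH _ _ (class_CW Cg) Cfi.
apply: (eq_class_C _ (class_CD C1 C2)) => x.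
by rewrite -(deriveM (dfi x) (dgi x)).
Qed.

(** The induction is over all exponents [r], because the derivative of [f^r] involves
    [f^(r - 1)]. *)
Lemma class_C_powR k f r : (forall x, 0 < f x) -> class_C k f ->
  class_C k (fun x => f x `^ r).
Proof.
move=> f0; elim: k r => [|k IH] r; first exact: continuous_powR_gt0.
move=> Cf; have [cf df] := Cf; split; first exact: continuous_powR_gt0.
move=> i; have [dfi Cfi] := df i.
have dx x : is_derive x (delta_mx ord0 i) (fun y => f y `^ r)
    (r * f x `^ (r - 1) * 'D_(delta_mx ord0 i) f x).
  by apply: is_derive_powR => //; exact: derivableP.
split => [x|]; first by have [] := dx x.
apply: (eq_class_C (g := fun x => r * f x `^ (r - 1) * 'D_(delta_mx ord0 i) f x)).
  by move=> x; have [] := dx x.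
apply: class_CM => //; apply: class_CM; first exact: class_C_cst.
by apply: IH; exact: class_CW.
Qed.

End smooth_functions.

(** * Lipschitz bounds for test functions *)

Section row_norm.
Context {R : realType} {n : nat}.
Implicit Types x : 'rV[R]_n.

Lemma row_coord_le_norm x i : `|x ord0 i| <= `|x|.
Proof.
by rewrite [leRHS]/Num.norm/= mx_normrE; apply/bigmax_geP; right => /=; exists (ord0, i).
Qed.

Lemma row_norm_le_enorm x : `|x| <= enorm x.
Proof.
have [->|x0] := eqVneq `|x| 0; first exact: sqrtr_ge0.
have [[i0 i]] := mx_norm_neq0 x0; rewrite /= (ord1 i0) => xi.
rewrite -[`|x|]/(mx_norm x) xi -sqrtr_sqr ler_wsqrtr//.
by rewrite (bigD1 i)//= lerDl sumr_ge0// => j _; exact: sqr_ge0.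
Qed.

End row_norm.

Lemma derivative_bound_lipschitz (R : realType) (g dg : R -> R) (M : R) :
  (forall t : R, is_derive t 1 g (dg t)) -> (forall t : R, `|dg t| <= M) ->
  forall a b, `|g a - g b| <= M * `|a - b|.
Proof.
move=> dgE dgM.
have main a b : a < b -> `|g b - g a| <= M * `|b - a|.
  move=> ab; have [c _ ->] : exists2 c, c \in `]a, b[%R & g b - g a = dg c * (b - a).
    apply: MVT => //; apply: derivable_within_continuous => t _.
    by have [] := dgE t.
  by rewrite normrM ler_wpM2r.
move=> a b; have [ab|ba|->] := ltgtP a b.
- by rewrite distrC (distrC a); exact: main.
- exact: main.
- by rewrite !subrr normr0 mulr0.
Qed.

Section lipschitz.
Context {R : realType} {N : nat}.
Implicit Types (f : 'rV[R]_N -> R) (x y : 'rV[R]_N).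

Let interp x y k : 'rV[R]_N := \row_i (if (i < k)%N then y ord0 i else x ord0 i).

(** The points [interp x y k] lead from [x] to [y] by changing one coordinate at a time; each of the
    [N] steps is estimated by the one-variable mean value theorem. *)
Lemma partial_bound_lipschitz f M :
  (forall i x, derivable f x (delta_mx ord0 i)) ->
  (forall i x, `|'D_(delta_mx ord0 i) f x| <= M) ->
  forall x y, `|f x - f y| <= N%:R * M * `|x - y|.
Proof.
move=> df dfM x y.
have step (i : 'I_N) : `|f (interp x y i) - f (interp x y i.+1)| <= M * `|x - y|.
  have M0 : 0 <= M by exact: le_trans (dfM i x).
  have lip := derivative_bound_lipschitz (fun t : R =>
    is_derive_line_at (derivableP (df i (t *: delta_mx ord0 i + interp x y i))))
    (fun t => dfM i _) 0 (y ord0 i - x ord0 i).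
  rewrite scale0r add0r in lip.
  have E : interp x y i.+1 =
      (y ord0 i - x ord0 i) *: delta_mx ord0 i + interp x y i.
    apply/rowP => j; rewrite !mxE eqxx /= ltnS leq_eqVlt.
    have [->|ji] := eqVneq j i; first by rewrite eqxx ltnn mulr1 subrK.
    by rewrite (val_eqE j i) (negbTE ji) mulr0 add0r.
  rewrite E; apply: le_trans lip _; rewrite ler_wpM2l// sub0r normrN distrC.
  by have := row_coord_le_norm (x - y) i; rewrite !mxE.
have f0 : interp x y 0 = x by apply/rowP => j; rewrite !mxE.
have fN : interp x y N = y by apply/rowP => j; rewrite !mxE ltn_ord.
have main k : (k <= N)%N -> `|f x - f (interp x y k)| <= k%:R * M * `|x - y|.
  elim: k => [|k IH] kN; first by rewrite f0 subrr normr0 !mul0r.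
  rewrite -natr1 !mulrDl mul1r.
  rewrite -(subrKA (f (interp x y k))) (le_trans (ler_normD _ _))// lerD//.
    by apply: IH; exact: ltnW.
  exact: (step (Ordinal kN)).
by rewrite -{1}fN; exact: main.
Qed.

Lemma compact_support_bounded f : continuous f ->
  compact (closure [set x | f x != 0]) -> exists M, forall x, `|f x| <= M.
Proof.
move=> cf cptf.
have /compact_bounded[M [_ fM]] :
    compact (f @` closure [set x | f x != 0]).
  by apply: continuous_compact => //; exact: continuous_subspaceT.
have M1 : M < `|M| + 1 by rewrite (le_lt_trans (ler_norm _))// ltrDl.
exists (`|M| + 1) => x; have [->|fx0] := eqVneq (f x) 0.
  by rewrite normr0 addr_ge0.
by apply: (fM _ M1); exists x => //; exact: subset_closure.
Qed.

Lemma derive_support f v x : ~ closure [set x | f x != 0] x -> 'D_v f x = 0.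
Proof.
move=> fx; rewrite -[RHS](derive_cst (V := 'rV[R]_N) (0 : R) x v).
apply: near_eq_derive.
have : nbhs x (~` closure [set x | f x != 0]).
  by apply: open_nbhs_nbhs; split => //; apply: closed_openC; exact: closed_closure.
apply: filterS => y ny; apply/eqP/negPn/negP => fy; apply: ny.
exact: subset_closure.
Qed.

Lemma test_function_lipschitz (Omega : set 'rV[R]_N) f : test_function Omega f ->
  exists2 L, 0 <= L & forall x y, `|f x - f y| <= L * `|x - y|.
Proof.
case=> Cf cptf _; have [cf df] := Cf 1%N.
(* A partial derivative is continuous and vanishes off the closed support of [f], so its own support
   is compact and it is bounded. *)
have bnd i : exists M, forall x, `|'D_(delta_mx ord0 i) f x| <= M.
  have [_ cdf] := df i; apply: compact_support_bounded => //.
  apply: subclosed_compact cptf _; first exact: closed_closure.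
  rewrite (_ : closure [set x | f x != 0] = closure (closure [set x | f x != 0])).
    apply: closure_subset => x /= dfx; apply: contrapT => nx; move: dfx.
    by rewrite derive_support// eqxx.
  by apply/closure_id; exact: closed_closure.
have [M MP] := choice bnd.
pose L := \sum_i `|M i|.
have L0 : 0 <= L by exact: sumr_ge0.
exists (N%:R * L); first by rewrite mulr_ge0.
apply: partial_bound_lipschitz => [i x|i x]; first by have [] := df i.
apply: le_trans (MP i x) _; rewrite /L (bigD1 i)//= (le_trans (ler_norm _))//.
by rewrite lerDl sumr_ge0.
Qed.

End lipschitz.

(** * Finiteness of the energy of Lipschitz functions *)

Section cover_criterion.
Context d (T : measurableType d) (R : realType) (mu : {measure set T -> \bar R}).

Lemma geometric_nneseries_lty (a r : R) : 0 <= a -> 0 < r < 1 ->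
  (\sum_(0 <= j <oo) (a * r ^+ j)%:E < +oo)%E.
Proof.
move=> a0 /andP[r0 r1].
apply: (@le_lt_trans _ _ (a / (1 - r))%:E); last exact: ltry.
apply: lime_le.
  by apply: is_cvg_nneseries => n _ _; rewrite lee_fin mulr_ge0// exprn_ge0// ltW.
apply: nearW => n; rewrite sumEFin lee_fin.
by apply: (geometric_le_lim n a0 r0); rewrite gtr0_norm.
Qed.

(** On [D] the function [F] is at most the series of the [c j * \1_(E j)], which can be integrated
    term by term and compared with a geometric series. The [E j] may overlap. *)
Lemma integral_lty_cover (D : set T) (F : T -> R) (E : nat -> set T) (c w : nat -> R)
    (a r : R) :
  measurable D -> measurable_fun setT F -> (forall z, 0 <= F z) ->
  (forall j, measurable (E j)) -> (forall j, 0 <= c j) ->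
  (forall j, mu (E j) <= (w j)%:E)%E ->
  (forall z, D z -> F z != 0 -> exists2 j, E j z & F z <= c j) ->
  0 <= a -> 0 < r < 1 -> (forall j, c j * w j <= a * r ^+ j) ->
  (\int[mu]_(z in D) (F z)%:E < +oo)%E.
Proof.
move=> mD mF F0 mE c0 Ew cover a0 r01 cwr.
have mcE j : measurable_fun D (fun z => (c j * \1_(E j) z)%:E).
  apply/measurable_EFinP; apply: measurable_funM; first exact: measurable_cst.
  exact: measurable_indic.
have cE0 j z : D z -> (0 <= (c j * \1_(E j) z)%:E)%E.
  by move=> _; rewrite lee_fin mulr_ge0.
apply: (@le_lt_trans _ _
    (\int[mu]_(z in D) \sum_(0 <= j <oo) (c j * \1_(E j) z)%:E)%E).
  apply: ge0_le_integral => //.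
  - by move=> z _; rewrite lee_fin.
  - by apply/measurable_EFinP; exact: measurable_funTS.
  - by apply: ge0_emeasurable_sum => // k z Dz _; exact: cE0.
  - move=> z Dz; have [->|Fz0] := eqVneq (F z) 0.
      by apply: nneseries_ge0 => n _ _; exact: cE0.
    have [j Ejz Fcj] := cover z Dz Fz0.
    apply: (@le_trans _ _ (\sum_(0 <= i < j.+1) (c i * \1_(E i) z)%:E)%E).
      rewrite big_nat_recr//= indicE mem_set// mulr1 -[X in (X <= _)%E]add0e.
      apply: leeD; last by rewrite lee_fin.
      by apply: sume_ge0 => i _; exact: cE0.
    by apply: nneseries_lim_ge => n _ _; exact: cE0.
rewrite integral_nneseries//.
apply: (le_lt_trans _ (geometric_nneseries_lty a0 r01)).
apply: lee_nneseries => [n _ _|n _]; first by apply: integral_ge0 => z; exact: cE0.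
apply: (@le_trans _ _ (c n * w n)%:E); last by rewrite lee_fin.
under eq_integral do rewrite EFinM.
rewrite ge0_integralZl//; first last.
- by rewrite lee_fin.
- by apply/measurable_EFinP; exact: measurable_indic.
rewrite integral_indic// EFinM lee_wpmul2l ?lee_fin//.
by apply: le_trans (Ew n); apply: le_measure; rewrite ?inE//; exact: measurableI.
Qed.

End cover_criterion.

(** * Tubes around the diagonal and their volume *)

Section tubes.
Context {R : realType} {N : nat}.
Local Notation leb := (@lebesgue_measure_rV R N).

Lemma measurable_row_box (A : 'I_N -> set R) : (forall i, measurable (A i)) ->
  measurable [set x : 'rV[R]_N | forall i, A i (x ord0 i)].
Proof.
move=> mA; rewrite (_ : [set _ | _] = \bigcap_(i in [set: 'I_N])
    (fun x : 'rV[R]_N => x ord0 i) @^-1` A i).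
  apply: fin_bigcap_measurable => // i _; rewrite -[X in measurable X]setTI.
  exact: measurable_rV_coord.
by apply/seteqP; split => [x Ax i _|x Ax i]; [exact: Ax|exact: (Ax i I)].
Qed.

Lemma lebesgue_measure_rV_cube (l : 'I_N -> R) (r : R) : 0 <= r ->
  leb [set x | forall i, x ord0 i \in `[l i, l i + r]] = (r ^+ N)%:E.
Proof.
move=> r0; rewrite (lebesgue_measure_rV_box (A := fun i => `[l i, l i + r]%classic)).
  rewrite (eq_bigr (fun=> r%:E)); first by rewrite prodEFin prodr_const card_ord.
  move=> i _; rewrite lebesgue_measure_itv/= lte_fin ltrDl.
  case: ltP => [_|r0']; first by rewrite -EFinD addrAC subrr add0r.
  by congr EFin; apply/eqP; rewrite eq_le r0 r0'.
by move=> i; exact: measurable_itv.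
Qed.

(** Exchanging the points turns integration over one variable into integration over the other, and
    the two iterated measures agree by uniqueness of the product measure. *)
Lemma product_lebesgue_swap (A : set ('rV[R]_N * 'rV[R]_N)) : measurable A ->
  (leb \x leb)%E [set z | A (z.2, z.1)] = (leb \x leb)%E A.
Proof.
move=> mA; transitivity ((leb \x^ leb)%E A); last first.
  apply/esym; apply: product_measure_unique => // B C mB mC.
  exact: product_measure2E.
rewrite /product_measure1 /product_measure2; apply: eq_integral => x _ /=.
by congr (leb _); apply/seteqP; split => y; rewrite /xsection /ysection /= !inE.
Qed.

(** The upper end is written [- b + 2 * b] to match the form [l i + r] in
    [lebesgue_measure_rV_cube]. *)
Definition tube (b r : R) := [set z : 'rV[R]_N * 'rV[R]_N |
  (forall i, z.1 ord0 i \in `[- b, - b + 2 * b]) /\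
  (forall i, z.1 ord0 i - z.2 ord0 i \in `[- r, r])].

Lemma measurable_tube b r : measurable (tube b r).
Proof.
have mbox (u v : R) : measurable [set x : 'rV[R]_N | forall i, x ord0 i \in `[u, v]].
  by apply: (measurable_row_box (A := fun=> `[u, v]%classic)) => i;
    exact: measurable_itv.
rewrite (_ : tube b r =
    (fst @^-1` [set x : 'rV[R]_N | forall i, x ord0 i \in `[- b, - b + 2 * b]]) `&`
    ((fun z : 'rV[R]_N * 'rV[R]_N => z.1 - z.2) @^-1`
      [set x : 'rV[R]_N | forall i, x ord0 i \in `[- r, r]])).
  apply: measurableI; rewrite -[X in measurable X]setTI.
    exact: measurable_fst.
  exact: measurable_row_sub.
apply/seteqP; split => z [z1 z2]; split => // i; have := z2 i; rewrite /= ?mxE//.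
Qed.

Lemma tube_measure b r : 0 <= b -> 0 <= r ->
  ((leb \x leb) (tube b r) <= ((2 * b) ^+ N * (2 * r) ^+ N)%:E)%E.
Proof.
move=> b0 r0; pose B := [set x : 'rV[R]_N | forall i, x ord0 i \in `[- b, - b + 2 * b]].
have mB : measurable B.
  by apply: (measurable_row_box (A := fun=> `[- b, - b + 2 * b]%classic)) => i;
    exact: measurable_itv.
apply: (@le_trans _ _ (\int[leb]_x (((2 * r) ^+ N)%:E * (\1_B x)%:E))%E); last first.
  rewrite ge0_integralZl//; last 2 first.
  - by apply/measurable_EFinP; exact: measurable_indic.
  - by rewrite lee_fin exprn_ge0// mulr_ge0.
  rewrite integral_indic// setIT.
  rewrite [X in (_ * X)%E](_ : _ = ((2 * b) ^+ N)%:E).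
    by rewrite -EFinM mulrC.
  by apply: (lebesgue_measure_rV_cube (fun=> - b)); rewrite mulr_ge0.
apply: ge0_le_integral => //.
- exact: (measurable_fun_xsection leb (measurable_tube b r)).
- apply/measurable_EFinP; apply: measurable_funM; first exact: measurable_cst.
  exact: measurable_indic.
move=> x _ /=; have [Bx|Bx] := pselect (B x).
  rewrite indicE mem_set//.
  have r20 : 0 <= 2 * r by rewrite mulr_ge0.
  rewrite mule1 -(lebesgue_measure_rV_cube (fun i => x ord0 i - r) r20).
  apply: le_measure; rewrite ?inE.
  - apply: measurable_xsection; exact: measurable_tube.
  - by apply: (measurable_row_box
      (A := fun i => `[x ord0 i - r, x ord0 i - r + 2 * r]%classic)) => i;
      exact: measurable_itv.
  - move=> y; rewrite /xsection/= inE => -[_ /= xy] i; have := xy i.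
    by rewrite !in_itv/= => /andP[h1 h2]; apply/andP; split; lra.
rewrite indicE memNset// mule0 (_ : xsection _ _ = set0) ?measure0//.
by apply/seteqP; split => y //; rewrite /xsection/= inE => -[].
Qed.

(** For [f z.1 - f z.2] to be nonzero, it is enough that one of the two points lies in the support,
    whichever it is. *)
Definition sym_tube (b r : R) : set ('rV[R]_N * 'rV[R]_N) :=
  tube b r `|` [set z | tube b r (z.2, z.1)].

Lemma measurable_sym_tube b r : measurable (sym_tube b r).
Proof.
apply: measurableU; first exact: measurable_tube.
rewrite -[X in measurable X]setTI; apply: (measurable_swap _ (measurable_tube b r)).
exact: measurableT.
Qed.

Lemma sym_tube_measure b r : 0 <= b -> 0 <= r ->
  ((leb \x leb) (sym_tube b r) <= (2 * ((2 * b) ^+ N * (2 * r) ^+ N))%:E)%E.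
Proof.
move=> b0 r0; have mt := measurable_tube b r.
have msw : measurable [set z | tube b r (z.2, z.1)].
  by rewrite -[X in measurable X]setTI; apply: (measurable_swap _ mt).
apply: (le_trans (measureU2 _ mt msw)).
rewrite mulr_natl mulr2n EFinD; apply: leeD; first exact: tube_measure.
by rewrite (le_trans _ (tube_measure b0 r0))// le_eqVlt -product_lebesgue_swap// eqxx.
Qed.

Lemma mem_sym_tube b r (z : 'rV[R]_N * 'rV[R]_N) :
  `|z.1| <= b \/ `|z.2| <= b -> `|z.1 - z.2| <= r -> sym_tube b r z.
Proof.
have cube (x : 'rV[R]_N) : `|x| <= b -> forall i, x ord0 i \in `[- b, - b + 2 * b].
  move=> xb i; have := le_trans (row_coord_le_norm x i) xb.
  by rewrite ler_norml in_itv/= => /andP[h1 h2]; apply/andP; split; lra.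
have near (x y : 'rV[R]_N) : `|x - y| <= r -> forall i, x ord0 i - y ord0 i \in `[- r, r].
  move=> xr i; have := le_trans (row_coord_le_norm (x - y) i) xr.
  by rewrite !mxE ler_norml in_itv.
case=> [b1|b2] zr; [left|right]; split => //=; try exact: cube; apply: near => //.
by rewrite distrC.
Qed.

End tubes.

Section energy.
Context {R : realType} {N : nat}.
Implicit Types (f g u : 'rV[R]_N -> R) (p s : R) (z : 'rV[R]_N * 'rV[R]_N).
Local Notation leb := (@lebesgue_measure_rV R N).

Definition kernel s p z : R := (enorm (z.1 - z.2) `^ (N%:R + s * p))^-1.

Definition energy s p f : \bar R :=
  (\int[leb \x leb]_z (`|f z.1 - f z.2| `^ p * kernel s p z)%:E)%E.

Lemma WnormE s p f : Wnorm s p f = (energy s p f `^ p^-1)%E.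
Proof. by []. Qed.

Lemma kernel_ge0 s p z : 0 <= kernel s p z.
Proof. by rewrite invr_ge0 powR_ge0. Qed.

Lemma measurable_enorm : measurable_fun setT (@enorm R N).
Proof.
rewrite (_ : @enorm R N = Num.sqrt \o (fun x : 'rV[R]_N => \sum_i x ord0 i ^+ 2))//.
apply: measurableT_comp.
  by apply: continuous_measurable_fun; exact: sqrt_continuous.
apply: measurable_sum => i; apply: measurable_funX; exact: measurable_rV_coord.
Qed.

Lemma measurable_kernel s p : measurable_fun setT (kernel s p).
Proof.
rewrite (_ : kernel s p = fun z => enorm (z.1 - z.2) `^ - (N%:R + s * p)); last first.
  by apply/funext => z; rewrite powRN.
apply: (measurableT_comp (measurable_powR _)); apply: (measurableT_comp measurable_enorm).
exact: measurable_row_sub.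
Qed.

Lemma measurable_diff f : measurable_fun setT f ->
  measurable_fun setT (fun z => f z.1 - f z.2).
Proof.
move=> mf; apply: measurable_funB.
  exact: (measurableT_comp mf measurable_fst).
exact: (measurableT_comp mf measurable_snd).
Qed.

Lemma measurable_diff_pow p f : measurable_fun setT f ->
  measurable_fun setT (fun z => `|f z.1 - f z.2| `^ p).
Proof.
by move=> mf; apply: measurable_norm_powR; exact: measurable_diff.
Qed.

Lemma measurable_energy_density s p f : measurable_fun setT f ->
  measurable_fun setT (fun z => `|f z.1 - f z.2| `^ p * kernel s p z).
Proof.
by move=> mf; apply: measurable_funM; [exact: measurable_diff_pow|exact: measurable_kernel].
Qed.

Lemma energy_density_ge0 s p f z : 0 <= `|f z.1 - f z.2| `^ p * kernel s p z.
Proof. by rewrite mulr_ge0 ?powR_ge0 ?kernel_ge0. Qed.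

Lemma energy_ge0 s p f : (0 <= energy s p f)%E.
Proof. by apply: integral_ge0 => z _; rewrite lee_fin energy_density_ge0. Qed.

Lemma powRXn (a r : R) n : 0 <= a -> (a ^+ n) `^ r = (a `^ r) ^+ n.
Proof.
by move=> a0; rewrite -powR_mulrn// -powRrM mulrC powRrM powR_mulrn ?powR_ge0.
Qed.

Lemma ex_exp2_gt (t : R) : exists n, t < 2 ^+ n.
Proof.
exists (Num.bound t); apply: le_lt_trans (ler_norm t) _.
apply: (lt_trans (archi_boundP (normr_ge0 t))).
rewrite /Num.bound normr_id -natrX ltr_nat; exact: ltn_expl.
Qed.

Lemma dyadic_near (t : R) : 0 < t <= 1 ->
  exists j, t <= 2^-1 ^+ j /\ 2^-1 ^+ j.+1 < t.
Proof.
move=> /andP[t0 t1].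
have ex : exists j, 2^-1 ^+ j.+1 < t.
  have [n tn] := ex_exp2_gt t^-1; exists n.
  rewrite exprVn invf_plt ?posrE ?exprn_gt0//; apply: (lt_le_trans tn).
  by rewrite exprS ler_peMl ?exprn_ge0// ler1n.
have [[|j] jt jmin] := ex_minnP ex; first by exists 0%N; rewrite expr0.
exists j.+1; split => //; rewrite leNgt; apply/negP => /jmin.
by rewrite ltnn.
Qed.

Lemma dyadic_far (t : R) : 1 < t -> exists j, t <= 2 ^+ j.+1 /\ 2 ^+ j < t.
Proof.
move=> t1.
have ex : exists j, t <= 2 ^+ j.+1.
  have [n tn] := ex_exp2_gt t; exists n; rewrite (le_trans (ltW tn))//.
  by rewrite exprS ler_peMl ?exprn_ge0// ler1n.
have [[|j] jt jmin] := ex_minnP ex; first by exists 0%N; rewrite expr0.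
exists j.+1; split => //; rewrite ltNge; apply/negP => /jmin.
by rewrite ltnn.
Qed.

(* Dyadic annuli around the diagonal: near it the Lipschitz bound gives a
   geometric series of ratio [2^(-p(1-s))], away from it the sup bound gives one
   of ratio [2^(-sp)]. *)
Lemma energy_lipschitz_lty s p f (M L b : R) : 1 < p -> 0 < s < 1 ->
  measurable_fun setT f -> (forall x, `|f x| <= M) -> 0 <= L ->
  (forall x y, `|f x - f y| <= L * `|x - y|) -> 0 <= b ->
  (forall x, f x != 0 -> `|x| <= b) ->
  (energy s p f < +oo)%E.
Proof.
move=> p1 /andP[s0 s1] mf fM L0 fL b0 fb.
have M0 : 0 <= M by exact: le_trans (fM 0).
have p0 : 0 < p by lra.
set sg := N%:R + s * p.
have sg0 : 0 < sg by rewrite ltr_wpDl// mulr_gt0.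
pose D := [set z : 'rV[R]_N * 'rV[R]_N | `|z.1 - z.2| <= 1].
have mD : measurable D.
  rewrite (_ : D = (fun z => `|z.1 - z.2|) @^-1` `]-oo, 1]%classic); last first.
    by apply/seteqP; split => z /=; rewrite in_itv.
  rewrite -[X in measurable X]setTI.
  apply: (measurableT_comp (continuous_measurable_row (@norm_continuous _ _))) => //.
  exact: measurable_row_sub.
pose F z := `|f z.1 - f z.2| `^ p * kernel s p z.
have mF : measurable_fun setT F by exact: measurable_energy_density.
have F0 z : 0 <= F z by exact: energy_density_ge0.
rewrite /energy -(setUv D) ge0_integral_setU; [|exact: mD|exact: measurableC| | |]; last 3 first.
- by rewrite setUv; apply/measurable_EFinP.
- by move=> z _; exact: F0.
- by apply/disj_setPS => z [].
(* The kernel is estimated through the sup norm, which is at most the Euclidean norm; this matches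
   the tubes, which are built from cubes. *)
have supp z : F z != 0 -> [/\ `|z.1| <= b \/ `|z.2| <= b, 0 < `|z.1 - z.2| &
    forall r, 0 < r -> r <= `|z.1 - z.2| -> kernel s p z <= r `^ (- sg)].
  move=> Fz; have fz : f z.1 != f z.2.
    apply: contra_neq Fz => fz; rewrite /F fz subrr normr0 powR0 ?mul0r// gt_eqF//.
  split.
  - have [f1|/fb] := eqVneq (f z.1) 0; last by left.
    by right; apply: fb; apply: contra_neq fz => ->.
  - by rewrite normr_gt0 subr_eq0; apply: contra_neq fz => ->.
  - move=> r r0 rz; rewrite powRN /kernel -/sg lef_pV2 ?posrE ?powR_gt0//; last first.
      exact: lt_le_trans (lt_le_trans r0 rz) (row_norm_le_enorm _).
    rewrite ge0_ler_powR ?nnegrE ?(ltW sg0) ?(ltW r0) ?sqrtr_ge0//.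
    exact: le_trans (row_norm_le_enorm _).
have half0 : 0 < (2^-1 : R) by rewrite invr_gt0.
have pow01 (r x : R) : 0 < r -> 0 < x < 1 -> 0 < x `^ r < 1.
  move=> r0 /andP[x0 x1]; rewrite powR_gt0//=.
  have := @gt0_ltr_powR R r r0 x 1; rewrite !nnegrE (ltW x0) ler01 powR1.
  by apply.
have half01 : 0 < (2^-1 : R) < 1 by rewrite half0/= invf_lt1// ltr1n.
apply: lte_add_pinfty.
- apply: (@integral_lty_cover _ _ _ (leb \x leb)%E D F
    (fun j => sym_tube b (2^-1 ^+ j))
    (fun j => L `^ p * (2^-1 ^+ j) `^ p * (2^-1 ^+ j.+1) `^ (- sg))
    (fun j => 2 * ((2 * b) ^+ N * (2 * 2^-1 ^+ j) ^+ N))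
    (L `^ p * 2 * (2 * b) ^+ N * 2 ^+ N * 2^-1 `^ (- sg))
    (2^-1 `^ (p * (1 - s)))) => //.
  + by move=> j; exact: measurable_sym_tube.
  + by move=> j; rewrite !mulr_ge0 ?powR_ge0.
  + by move=> j; apply: sym_tube_measure => //; rewrite exprn_ge0// ltW.
  + move=> z Dz /supp[zb z0 K].
    have [j [zj jz]] : exists j, `|z.1 - z.2| <= 2^-1 ^+ j /\ 2^-1 ^+ j.+1 < `|z.1 - z.2|.
      by apply: dyadic_near; rewrite z0.
    exists j; first exact: mem_sym_tube.
    rewrite /F ler_pM ?powR_ge0 ?kernel_ge0//; last first.
      by apply: K; rewrite ?exprn_gt0// ltW.
    rewrite -powRM ?exprn_ge0 ?(ltW half0)// ge0_ler_powR ?nnegrE ?(ltW p0)//.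
      by rewrite mulr_ge0 ?exprn_ge0 ?(ltW half0).
    by apply: (le_trans (fL _ _)); rewrite ler_wpM2l.
  + by rewrite !mulr_ge0 ?powR_ge0 ?exprn_ge0// mulr_ge0.
  + by apply: pow01 => //; rewrite mulr_gt0// subr_gt0.
  + move=> j; rewrite !powRXn ?(ltW half0)//.
    (* The exponents are [p] from the Lipschitz bound, [N] from the volume and [- sg] from the
       kernel. The last factor of the constant appears because the kernel is bounded at the inner
       radius [2^-1 ^+ j.+1]. *)
    rewrite (_ : p * (1 - s) = p + N%:R + - sg); last by rewrite /sg; ring.
    rewrite !powRD_gt0// powR_mulrn ?(ltW half0)//.
    set A := 2^-1 `^ p; set B := 2^-1 `^ (- sg).
    rewrite (_ : B ^+ j.+1 = B * B ^+ j) ?exprS// !exprMn (exprAC _ j N).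
    by rewrite le_eqVlt; apply/orP; left; apply/eqP; ring.
- apply: (@integral_lty_cover _ _ _ (leb \x leb)%E (~` D) F
    (fun j => sym_tube b (2 ^+ j.+1))
    (fun j => (2 * M) `^ p * (2 ^+ j) `^ (- sg))
    (fun j => 2 * ((2 * b) ^+ N * (2 * 2 ^+ j.+1) ^+ N))
    ((2 * M) `^ p * 2 * (2 * b) ^+ N * 2 ^+ N * 2 ^+ N)
    (2 `^ (- (s * p)))) => //.
  + exact: measurableC.
  + by move=> j; exact: measurable_sym_tube.
  + by move=> j; rewrite !mulr_ge0 ?powR_ge0.
  + by move=> j; apply: sym_tube_measure => //; rewrite exprn_ge0.
  + move=> z /= /negP; rewrite -ltNge => Dz /supp[zb z0 K].
    have [j [zj jz]] := dyadic_far Dz.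
    exists j; first exact: mem_sym_tube.
    rewrite /F ler_pM ?powR_ge0 ?kernel_ge0//; last first.
      by apply: K; rewrite ?exprn_gt0// ltW.
    rewrite ge0_ler_powR ?nnegrE ?(ltW p0) ?mulr_ge0//.
    by rewrite mulr_natl mulr2n (le_trans (ler_normB _ _))// lerD.
  + by rewrite !mulr_ge0 ?powR_ge0 ?exprn_ge0// mulr_ge0.
  + have := pow01 (s * p) 2^-1; rewrite mulr_gt0// half01 => /(_ isT isT).
    by rewrite -powR_inv1// -powRrM mulN1r.
  + move=> j; rewrite !powRXn//.
    (* The sup bound does not scale with [j], so only volume and kernel contribute. The second
       [2 ^+ N] of the constant comes from the outer radius [2 ^+ j.+1]. *)
    rewrite (_ : - (s * p) = N%:R + - sg); last by rewrite /sg; ring.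
    rewrite powRD_gt0// powR_mulrn//.
    set A := (2 * M) `^ p; set B := 2 `^ (- sg).
    rewrite (_ : 2 ^+ j.+1 = 2 * 2 ^+ j :> R) ?exprS// !exprMn (exprAC _ j N).
    by rewrite le_eqVlt; apply/orP; left; apply/eqP; ring.
Qed.

End energy.

(** * Limits of energies *)

Section nonnegative_ereal_sequences.
Context {R : realType}.
Implicit Types (a b : nat -> \bar R) (x : \bar R) (r e : R).

Lemma cvge0P a : (forall k, (0 <= a k)%E) ->
  a k @[k --> \oo] --> 0%E <-> forall e, 0 < e -> \forall k \near \oo, (a k < e%:E)%E.
Proof.
move=> a0; split => [/fine_cvgP[afin /cvgr0Pnorm_lt ac] e e0|h].
  near=> k; have akf : a k \is a fin_num by near: k.
  rewrite -(fineK akf) lte_fin; apply: le_lt_trans (ler_norm _) _.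
  by near: k; exact: ac.
apply/fine_cvgP; split.
  apply: filterS (h 1 ltr01) => k ak; rewrite ge0_fin_numE//.
  exact: lt_trans ak (ltry _).
apply/cvgr0Pnorm_lt => e e0; apply: filterS (h e e0) => k ak /=.
have akf : a k \is a fin_num by rewrite ge0_fin_numE// (lt_trans ak)// ltry.
by rewrite ger0_norm ?fine_ge0// -lte_fin fineK.
Unshelve. all: by end_near. Qed.

Lemma cvge0_le a b : (forall k, (0 <= a k <= b k)%E) ->
  b k @[k --> \oo] --> 0%E -> a k @[k --> \oo] --> 0%E.
Proof.
move=> ab; have a0 k : (0 <= a k)%E by have /andP[] := ab k.
have b0 k : (0 <= b k)%E by have /andP[h1 h2] := ab k; exact: le_trans h1 h2.
move=> /(cvge0P b0) hb; apply/(cvge0P a0) => e /hb; apply: filterS => k.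
by apply: le_lt_trans; have /andP[] := ab k.
Qed.

Lemma poweR_lt x r e : 0 < r -> 0 < e -> (0 <= x)%E -> (x < e%:E)%E ->
  (x `^ r < (e `^ r)%:E)%E.
Proof.
move=> r0 e0; case: x => [x| |]//; rewrite !lee_fin !lte_fin => x0 xe /=.
by rewrite gt0_ltr_powR// nnegrE// ltW.
Qed.

Lemma poweR_cvg0 a r : 0 < r -> (forall k, (0 <= a k)%E) ->
  a k @[k --> \oo] --> 0%E -> (a k `^ r)%E @[k --> \oo] --> 0%E.
Proof.
move=> r0 a0 /(cvge0P a0) h; apply/cvge0P => [k|e e0]; first exact: poweR_ge0.
have er0 : 0 < e `^ r^-1 by exact: powR_gt0.
apply: filterS (h _ er0) => k ak; have := poweR_lt r0 er0 (a0 k) ak.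
by rewrite -powRrM mulVf ?gt_eqF// powRr1// ltW.
Qed.

End nonnegative_ereal_sequences.

Lemma powRD_le (R : realType) (p a b : R) : 0 <= p -> 0 <= a -> 0 <= b ->
  (a + b) `^ p <= 2 `^ p * (a `^ p + b `^ p).
Proof.
move=> p0 a0 b0.
wlog ab : a b a0 b0 / a <= b.
  move=> h; have [ab|/ltW ba] := leP a b; first exact: h.
  by rewrite addrC (addrC (a `^ p)); exact: h.
apply: (@le_trans _ _ ((2 * b) `^ p)).
  by rewrite ge0_ler_powR ?nnegrE ?addr_ge0 ?mulr_ge0// mulr_natl mulr2n lerD2r.
by rewrite powRM// ler_wpM2l ?powR_ge0// lerDr powR_ge0.
Qed.

Lemma continuous_norm_powR (R : realType) (p : R) : 0 < p ->
  continuous (fun x : R => `|x| `^ p).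
Proof.
move=> p0 x; have [->|x0] := eqVneq x 0.
  rewrite /continuous_at normr0 powR0 ?gt_eqF//; apply/cvgr0Pnorm_lt => e e0.
  have ep : 0 < e `^ p^-1 by exact: powR_gt0.
  exists (e `^ p^-1) => //= y /=; rewrite sub0r normrN => ye.
  rewrite ger0_norm ?powR_ge0//.
  have := @gt0_ltr_powR R p p0 `|y| (e `^ p^-1).
  rewrite !nnegrE normr_ge0 powR_ge0 -powRrM mulVf ?gt_eqF// powRr1 ?ltW//.
  by apply.
apply: (@continuous_comp _ _ _ (fun y : R => `|y|) (fun y => y `^ p)).
  exact: norm_continuous.
apply: differentiable_continuous; apply/derivable1_diffP.
by have [] := @is_derive1_powR R p `|x| _; rewrite ?normr_gt0.
Qed.

Lemma cvg_norm_powR (R : realType) (p : R) (a : nat -> R) (l : R) : 0 < p ->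
  a k @[k --> \oo] --> l -> `|a k| `^ p @[k --> \oo] --> `|l| `^ p.
Proof.
move=> p0 al.
exact: (@cvg_comp _ _ _ a (fun x : R => `|x| `^ p) _ (nbhs l) _ al
  (continuous_norm_powR p0 (x := l))).
Qed.

(** * Scaling, comparison and dominated convergence for the energy *)

Section energy_space.
Context {R : realType} {N : nat}.
Implicit Types (f g h u : 'rV[R]_N -> R) (p s : R) (z : 'rV[R]_N * 'rV[R]_N).
Local Notation leb := (@lebesgue_measure_rV R N).
Local Notation leb2 := (leb \x leb)%E.
Local Notation density s p f :=
  (fun z => (`|f z.1 - f z.2| `^ p * kernel s p z)%:E).

Lemma energy_Wnorm s p f : 0 < p -> energy s p f = (Wnorm s p f `^ p)%E.
Proof.
move=> p0; rewrite WnormE -poweRrM mulVf ?gt_eqF// poweRe1//; exact: energy_ge0.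
Qed.

Lemma measurable_density s p f : measurable_fun setT f ->
  measurable_fun setT (density s p f).
Proof. by move=> mf; apply/measurable_EFinP; exact: measurable_energy_density. Qed.

Lemma integrable_density s p f : measurable_fun setT f -> (energy s p f < +oo)%E ->
  leb2.-integrable setT (density s p f).
Proof.
move=> mf ef; apply/integrableP; split; first exact: measurable_density.
under eq_integral do rewrite gee0_abs ?lee_fin ?energy_density_ge0//.
exact: ef.
Qed.

Lemma energyZ s p f c : 0 < p -> measurable_fun setT f ->
  energy s p (fun x => c * f x) = ((`|c| `^ p)%:E * energy s p f)%E.
Proof.
move=> p0 mf.
transitivity (\int[leb2]_z ((`|c| `^ p)%:E * density s p f z))%E.
  by apply: eq_integral => z _; rewrite -mulrBr normrM powRM// -mulrA EFinM.
apply: ge0_integralZl => //; first exact: measurable_density.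
  by move=> z _; rewrite lee_fin energy_density_ge0.
Qed.

Lemma le_density s p f g h z : 0 < p ->
  `|f z.1 - f z.2| <= `|g z.1 - g z.2| + `|h z.1 - h z.2| ->
  `|f z.1 - f z.2| `^ p * kernel s p z <= 2 `^ p *
    (`|g z.1 - g z.2| `^ p * kernel s p z + `|h z.1 - h z.2| `^ p * kernel s p z).
Proof.
move=> p0 fgh; rewrite -mulrDl mulrA ler_wpM2r ?kernel_ge0//.
apply: le_trans (powRD_le (ltW p0) (normr_ge0 _) (normr_ge0 _)).
by rewrite ge0_ler_powR ?nnegrE ?addr_ge0// ltW.
Qed.

Lemma energy_le s p f g h : 0 < p ->
  measurable_fun setT f -> measurable_fun setT g -> measurable_fun setT h ->
  (forall z, `|f z.1 - f z.2| <= `|g z.1 - g z.2| + `|h z.1 - h z.2|) ->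
  (energy s p f <= (2 `^ p)%:E * (energy s p g + energy s p h))%E.
Proof.
move=> p0 mf mg mh fgh.
have d0 (k : 'rV[R]_N -> R) z : (0 <= density s p k z)%E.
  by rewrite lee_fin energy_density_ge0.
have dm k := @measurable_density s p k.
have d2m : measurable_fun setT (fun z => density s p g z + density s p h z)%E.
  by apply: emeasurable_funD; exact: dm.
have -> : (energy s p g + energy s p h =
    \int[leb2]_z (density s p g z + density s p h z))%E.
  by rewrite ge0_integralD//; exact: dm.
have -> : ((2 `^ p)%:E * \int[leb2]_z (density s p g z + density s p h z) =
    \int[leb2]_z ((2 `^ p)%:E * (density s p g z + density s p h z)))%E.
  apply/esym; apply: ge0_integralZl => // z _; exact: adde_ge0.
apply: ge0_le_integral => //; first exact: dm.
- by apply: emeasurable_funM; first exact: measurable_cst.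
- by move=> z _; rewrite -EFinD -EFinM lee_fin le_density.
Qed.

Lemma energy_lty_le s p f g h : 0 < p ->
  measurable_fun setT f -> measurable_fun setT g -> measurable_fun setT h ->
  (forall z, `|f z.1 - f z.2| <= `|g z.1 - g z.2| + `|h z.1 - h z.2|) ->
  (energy s p g < +oo)%E -> (energy s p h < +oo)%E -> (energy s p f < +oo)%E.
Proof.
move=> p0 mf mg mh fgh eg eh; apply: (le_lt_trans (energy_le s p0 mf mg mh fgh)).
have gf : energy s p g \is a fin_num.
  by rewrite ge0_fin_numE; [exact: eg|exact: energy_ge0].
have hf : energy s p h \is a fin_num.
  by rewrite ge0_fin_numE; [exact: eh|exact: energy_ge0].
by rewrite -(fineK gf) -(fineK hf) -EFinD -EFinM ltry.
Qed.

Lemma test_function_measurable (Omega : set 'rV[R]_N) f :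
  test_function Omega f -> measurable_fun setT f.
Proof. by case=> /(_ 0%N) /= cf _ _; exact: continuous_measurable_row. Qed.

Lemma test_function_bounded (Omega : set 'rV[R]_N) f :
  test_function Omega f -> exists M, forall x, `|f x| <= M.
Proof. by case=> /(_ 0%N) /= cf cpt _; exact: compact_support_bounded. Qed.

Lemma test_function_energy s p (Omega : set 'rV[R]_N) f : 1 < p -> 0 < s < 1 ->
  test_function Omega f -> (energy s p f < +oo)%E.
Proof.
move=> p1 s01 tf; have [L L0 fL] := test_function_lipschitz tf.
have [M fM] := test_function_bounded tf.
have mf := test_function_measurable tf; case: tf => _ cpt _.
have /compact_bounded[b [_ fb]] := cpt.
have b1 : b < `|b| + 1 by rewrite (le_lt_trans (ler_norm _))// ltrDl.
apply: (energy_lipschitz_lty (b := `|b| + 1) p1 s01 mf fM L0 fL).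
  by rewrite addr_ge0.
by move=> x fx; apply: (fb _ b1); exact: subset_closure.
Qed.

(* The dominating function [g] controls the densities of the sequence; by the
   triangle inequality it then also controls those of the differences. *)
Lemma energy_dominated s p (f_ : nat -> 'rV[R]_N -> R) f (g : _ -> \bar R) : 0 < p ->
  (forall k, measurable_fun setT (f_ k)) -> measurable_fun setT f ->
  leb2.-integrable setT g ->
  (forall k z, (density s p (f_ k) z <= g z)%E) ->
  {ae leb2, forall z, (f_ k z.1 - f_ k z.2) @[k --> \oo] --> f z.1 - f z.2} ->
  energy s p (f_ k) @[k --> \oo] --> energy s p f /\
  energy s p (fun x => f_ k x - f x) @[k --> \oo] --> 0%E.
Proof.
move=> p0 mf_ mf ig f_g cf.
have cD : {ae leb2, forall z, density s p (f_ k) z @[k --> \oo] --> density s p f z}.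
  apply: filterS cf => z cz; apply: cvg_EFin; first exact: nearW.
  apply: cvgM; last exact: cvg_cst.
  exact: cvg_norm_powR.
have gf : {ae leb2, forall z, (density s p f z <= g z)%E}.
  apply: filterS cD => z cz; rewrite -(cvg_lim _ cz)//.
  by apply: lime_le; [apply/cvg_ex; exists (density s p f z)|exact: nearW].
have absD h z : `|density s p h z|%E = density s p h z.
  by rewrite gee0_abs// lee_fin energy_density_ge0.
have mD h : measurable_fun setT h -> measurable_fun setT (density s p h).
  exact: measurable_density.
split.
  have [] := @dominated_convergence _ _ _ leb2 setT measurableT
    (fun k => density s p (f_ k)) (density s p f) g.
  - by move=> k; exact: mD.
  - exact: mD.
  - by apply: filterS cD.
  - by [].
  - by apply: nearW => z k _; rewrite absD.
  - by [].
have [] := @dominated_convergence _ _ _ leb2 setT measurableT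
  (fun k => density s p (fun x => f_ k x - f x)) (cst 0%E)
  (fun z => ((2 `^ p)%:E * (g z + g z))%E).
- by move=> k; apply: (mD (fun x => f_ k x - f x)); exact: measurable_funB.
- exact: measurable_cst.
- apply: filterS cf => z cz _; rewrite /cst.
  suff h : `|f_ k z.1 - f z.1 - (f_ k z.2 - f z.2)| `^ p * kernel s p z
      @[k --> \oo] --> (0 : R) by apply: cvg_EFin => //; exact: nearW.
  have -> : (0 : R) = `|(f z.1 - f z.2) - (f z.1 - f z.2)| `^ p * kernel s p z.
    by rewrite subrr normr0 powR0 ?gt_eqF// mul0r.
  apply: cvgM; last exact: cvg_cst.
  apply: cvg_norm_powR => //.
  rewrite (_ : (fun k => _) = fun k => (f_ k z.1 - f_ k z.2) - (f z.1 - f z.2)).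
    by apply: cvgB => //; exact: cvg_cst.
  by apply/funext => k; ring.
- by apply: integrableZl => //; exact: integrableD.
- apply: filterS gf => z gz k _; rewrite gee0_abs; last first.
    by rewrite lee_fin; exact: (energy_density_ge0 s p (fun x => f_ k x - f x)).
  apply: (@le_trans _ _ ((2 `^ p)%:E * (density s p (f_ k) z + density s p f z))%E).
    rewrite -EFinD -EFinM lee_fin.
    apply: (le_density s (f := fun x => f_ k x - f x)) => //.
    rewrite (_ : _ - _ - _ = (f_ k z.1 - f_ k z.2) - (f z.1 - f z.2)); last by ring.
    exact: ler_normB.
  by rewrite lee_wpmul2l ?lee_fin ?powR_ge0// leeD.
by rewrite integral0.
Qed.

End energy_space.

(** * Approximation by test functions *)

Section approximation.
Context {R : realType} {N : nat}.
Implicit Types (f g h u : 'rV[R]_N -> R) (p s : R) (z : 'rV[R]_N * 'rV[R]_N)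
  (Omega : set 'rV[R]_N) (phi : nat -> 'rV[R]_N -> R).
Local Notation leb := (@lebesgue_measure_rV R N).
Local Notation leb2 := (leb \x leb)%E.
Local Notation density s p f :=
  (fun z => (`|f z.1 - f z.2| `^ p * kernel s p z)%:E).

(** A subsequence is taken so that the errors are summable; this is what makes [defect]
    integrable. *)
Lemma W0_approx s p Omega u : 0 < p -> W0 s p Omega u ->
  exists phi, (forall k, test_function Omega (phi k)) /\
    forall k, (energy s p (fun x => (phi k x - u x)%R) <= (2^-1 ^+ k)%:E)%E.
Proof.
move=> p0 [_ _ [phi [tphi cphi]]].
have e0 k : (0 <= energy s p (fun x => (phi k x - u x)%R))%E by exact: energy_ge0.
have ce : energy s p (fun x => phi k x - u x) @[k --> \oo] --> 0%E.
  rewrite (_ : (fun k => _) = fun k =>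
      (Wnorm s p (fun x => (phi k x - u x)%R) `^ p)%E).
    by apply: poweR_cvg0 => // k; exact: poweR_ge0.
  by apply/funext => k; rewrite energy_Wnorm.
have /choice[n nP] : forall k, exists n,
    (energy s p (fun x => (phi n x - u x)%R) <= (2^-1 ^+ k)%:E)%E.
  move=> k; have /((cvge0P e0).1 ce)[m _ mP] : 0 < 2^-1 ^+ k :> R.
    by rewrite exprn_gt0// invr_gt0.
  by exists m; apply: ltW; apply: mP => /=.
by exists (phi \o n); split => [k|k]; [exact: tphi|exact: nP].
Qed.

Lemma kernel_gt0 s p z : z.1 != z.2 -> 0 < kernel s p z.
Proof.
move=> z12; rewrite invr_gt0 powR_gt0// (lt_le_trans _ (row_norm_le_enorm _))//.
by rewrite normr_gt0 subr_eq0.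
Qed.

Section sequence.
Variables (s p : R) (Omega : set 'rV[R]_N) (u : 'rV[R]_N -> R)
  (phi : nat -> 'rV[R]_N -> R).
Hypotheses (p1 : 1 < p) (s01 : 0 < s < 1) (mu : measurable_fun setT u)
  (tphi : forall k, test_function Omega (phi k))
  (ephi : forall k,
    (energy s p (fun x => (phi k x - u x)%R) <= (2^-1 ^+ k)%:E)%E).

Let p0 : 0 < p. Proof. exact: lt_trans p1. Qed.

Let delta k x := phi k x - u x.

Let mphi k : measurable_fun setT (phi k).
Proof. exact: test_function_measurable (tphi k). Qed.

Let mdelta k : measurable_fun setT (delta k).
Proof. exact: measurable_funB. Qed.

(** The series used to extract a.e. convergence from convergence in L^p. Its finiteness a.e. gives
    the pointwise limit, and its integrability gives a majorant common to all [k]. *)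
Definition defect z : \bar R := (\sum_(0 <= k <oo) density s p (delta k) z)%E.

Let density_ge0 f z : (0 <= density s p f z)%E.
Proof. by rewrite lee_fin energy_density_ge0. Qed.

Lemma density_le_defect k z : (density s p (delta k) z <= defect z)%E.
Proof.
apply: (@le_trans _ _ (\sum_(0 <= i < k.+1) density s p (delta i) z)%E).
  rewrite big_nat_recr//= -[X in (X <= _)%E]add0e; apply: leeD => //.
  by apply: sume_ge0 => i _; exact: density_ge0.
by apply: nneseries_lim_ge => n _ _; exact: density_ge0.
Qed.

Lemma defect_ge0 z : (0 <= defect z)%E.
Proof. by apply: nneseries_ge0 => n _ _; exact: density_ge0. Qed.

Lemma integrable_defect : leb2.-integrable setT defect.
Proof.
have md k : measurable_fun setT (density s p (delta k)) by exact: measurable_density.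
apply/integrableP; split.
  apply: ge0_emeasurable_sum => // k z _ _; exact: density_ge0.
under eq_integral do rewrite gee0_abs ?defect_ge0//.
rewrite /defect integral_nneseries//.
apply: (@le_lt_trans _ _ (\sum_(0 <= k <oo) (1 * 2^-1 ^+ k)%:E)%E); last first.
  apply: geometric_nneseries_lty => //.
  by rewrite invr_gt0 ltr0n/= invf_lt1// ltr1n.
apply: lee_nneseries => [k _ _|k _]; first by apply: integral_ge0 => z _; exact: density_ge0.
by rewrite mul1r; exact: ephi.
Qed.

(** Where [defect] is finite its terms tend to 0, and off the diagonal the positive kernel can be
    divided out. On the diagonal both differences are 0. *)
Lemma ae_diff_cvg :
  {ae leb2, forall z, phi k z.1 - phi k z.2 @[k --> \oo] --> u z.1 - u z.2}.
Proof.
apply: filterS (integrable_ae measurableT integrable_defect) => z /(_ I) fz.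
have [z12|z12] := eqVneq z.1 z.2.
  by rewrite z12 subrr; under eq_fun do rewrite subrr; exact: cvg_cst.
have K0 := kernel_gt0 s p z12.
have tail : (\sum_(n <= k <oo) density s p (delta k) z)%E @[n --> \oo] --> 0%E.
  apply: nneseries_tail_cvg => [|k _]; last exact: density_ge0.
  by rewrite -ge0_fin_numE//; exact: defect_ge0.
have dens0 : density s p (delta k) z @[k --> \oo] --> 0%E.
  apply: cvge0_le tail => k; rewrite density_ge0/=.
  apply: (@le_trans _ _ (\sum_(k <= i < k.+1) density s p (delta i) z)%E).
    by rewrite big_nat1.
  by apply: nneseries_lim_ge => n _ _; exact: density_ge0.
apply/cvgrPdist_lt => e e0.
have eK : 0 < e `^ p * kernel s p z by rewrite mulr_gt0// powR_gt0.
have := (cvge0P (fun k => density_ge0 (delta k) z)).1 dens0 _ eK.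
apply: filterS => k; rewrite lte_fin ltr_pM2r// => h.
rewrite distrC (_ : _ - _ - _ = delta k z.1 - delta k z.2); last by rewrite /delta; ring.
rewrite ltNge; apply/negP => eh; move: h; rewrite ltNge => /negP; apply.
by rewrite ge0_ler_powR ?nnegrE// ltW.
Qed.

(** Almost every [y] is a good base point for the convergence of differences. Since the complement
    of [Omega] is not null, [y] can be chosen there with [u y = 0]; every [phi k y] is 0 as well, so
    the difference with base point [y] is the function itself up to sign. *)
Lemma ae_cvg : ~ {ae leb, forall x, Omega x} ->
  {ae leb, forall x, ~ Omega x -> u x = 0} ->
  {ae leb, forall x, phi k x @[k --> \oo] --> u x}.
Proof.
move=> nO u0; have cz := ae_xsection ae_diff_cvg.
apply: contrapT => ncv; apply: nO.
apply: (filterS2 _ _ cz u0) => y cy uy.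
apply: contrapT => nOy; apply: ncv; apply: filterS cy => x /=.
rewrite (uy nOy) sub0r => cx.
have phiy k : phi k y = 0.
  apply/eqP/negPn/negP => fy; apply: nOy.
  by have [_ _] := tphi k; apply; exact: subset_closure.
rewrite -[u x]opprK (_ : (fun k => phi k x) = fun k => - (phi k y - phi k x)).
  exact: cvgN.
by apply/funext => k; rewrite phiy sub0r opprK.
Qed.

Lemma limit_energy_lty : (energy s p u < +oo)%E.
Proof.
apply: (@energy_lty_le _ _ s p u (phi 0) (delta 0)) => //.
- move=> z; rewrite (_ : u z.1 - u z.2 =
    (phi 0 z.1 - phi 0 z.2) - (delta 0 z.1 - delta 0 z.2)); last by rewrite /delta; ring.
  exact: ler_normB.
- exact: test_function_energy (tphi 0).
- by apply: (le_lt_trans (ephi 0)); exact: ltry.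
Qed.

Lemma approx_density_le k z :
  (density s p (phi k) z <= (2 `^ p)%:E * (density s p u z + defect z))%E.
Proof.
apply: (@le_trans _ _ ((2 `^ p)%:E * (density s p u z + density s p (delta k) z))%E).
  rewrite -EFinD -EFinM lee_fin; apply: le_density => //.
  rewrite (_ : phi k z.1 - phi k z.2 =
    (u z.1 - u z.2) + (delta k z.1 - delta k z.2)); last by rewrite /delta; ring.
  exact: ler_normD.
rewrite lee_wpmul2l ?lee_fin ?powR_ge0// leeD2l//; exact: density_le_defect.
Qed.

Lemma approx_energy_cvg : energy s p (phi k) @[k --> \oo] --> energy s p u.
Proof.
apply: (energy_dominated p0 mphi mu _ approx_density_le ae_diff_cvg).1.
apply: integrableZl => //; apply: integrableD => //; last exact: integrable_defect.
by apply: integrable_density => //; exact: limit_energy_lty.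
Qed.

End sequence.

Lemma W0_energy_lty s p Omega u : 1 < p -> 0 < s < 1 -> W0 s p Omega u ->
  (energy s p u < +oo)%E.
Proof.
move=> p1 s01 W0u; have [mu _ _] := W0u.
have [phi [tphi ephi]] := W0_approx (lt_trans ltr01 p1) W0u.
exact: limit_energy_lty tphi ephi.
Qed.

End approximation.

(** * Regularized quotients *)

Lemma bounded_complement_nonnull (R : realType) N (Omega : set 'rV[R]_N) :
  (0 < N)%N -> bounded_set Omega ->
  ~ {ae lebesgue_measure_rV N, forall x, Omega x}.
Proof.
move=> N0 [M [_ OM]] aeO.
have M1 : M < `|M| + 1 by rewrite (le_lt_trans (ler_norm _))// ltrDl.
(* Points of [Omega] have norm at most [|M| + 1], so this cube of volume 1 misses [Omega]. *)
pose c := `|M| + 2; pose Q := [set x : 'rV[R]_N | forall i, x ord0 i \in `[c, c + 1]].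
have QE : lebesgue_measure_rV N Q = 1%E.
  by rewrite (lebesgue_measure_rV_cube (fun=> c))// expr1n.
have mQ : measurable Q.
  by apply: (measurable_row_box (A := fun=> `[c, c + 1]%classic)) => i;
    exact: measurable_itv.
have /(measure_negligible mQ) : (lebesgue_measure_rV N).-negligible Q.
  apply: negligibleS aeO => x Qx /= Ox; have := OM _ M1 x Ox.
  have := Qx (Ordinal N0); rewrite in_itv/= => /andP[cx _] xM.
  have := le_trans (row_coord_le_norm x (Ordinal N0)) xM.
  have := le_trans cx (ler_norm _); rewrite /c; lra.
by rewrite /= QE => /eqP; rewrite onee_eq0.
Qed.

Section regularized_modulus.
Context {R : realType}.
Implicit Types (a b e q r x y C M : R).

(** The smooth substitute [sqrt (a^2 + e^2)] for [|a|], written with products and a real power so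
    that [class_CM] and [class_C_powR] apply. *)
Definition regabs e a := (a * a + e * e) `^ 2^-1.

Lemma regabs_sqr e a : regabs e a ^+ 2 = a * a + e * e.
Proof.
have s0 : 0 <= a * a + e * e by rewrite -!expr2 addr_ge0 ?sqr_ge0.
by rewrite /regabs powR12_sqrt// sqr_sqrtr.
Qed.

Lemma regabs_ge0 e a : 0 <= regabs e a.
Proof. exact: powR_ge0. Qed.

Lemma regabs_norm_le e a : `|a| <= regabs e a.
Proof.
rewrite -(@ler_pXn2r _ 2)// ?nnegrE ?regabs_ge0// regabs_sqr real_normK ?num_real//.
by rewrite expr2 lerDl -expr2 sqr_ge0.
Qed.

Lemma regabs_ge e a : 0 <= e -> e <= regabs e a.
Proof.
move=> e0; rewrite -(@ler_pXn2r _ 2)// ?nnegrE ?regabs_ge0// regabs_sqr.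
by rewrite expr2 lerDr -expr2 sqr_ge0.
Qed.

Lemma regabs_le e a : 0 <= e -> regabs e a <= `|a| + e.
Proof.
move=> e0; rewrite -(@ler_pXn2r _ 2)// ?nnegrE ?regabs_ge0 ?addr_ge0// regabs_sqr.
rewrite sqrrD real_normK ?num_real// !expr2.
by rewrite -addrA lerD2l lerDr mulrn_wge0// mulr_ge0.
Qed.

Lemma regabs0 e : 0 <= e -> regabs e 0 = e.
Proof.
move=> e0; apply/eqP; rewrite eq_le regabs_ge// andbT.
by rewrite (le_trans (regabs_le 0 e0))// normr0 add0r.
Qed.

Lemma regabs_lipschitz e a b : 0 < e -> `|regabs e a - regabs e b| <= `|a - b|.
Proof.
move=> e0; have s0 : 0 < regabs e a + regabs e b.
  by rewrite addr_gt0// (lt_le_trans e0)// regabs_ge// ltW.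
rewrite -(ler_pM2r s0) -[X in _ * X <= _](gtr0_norm s0) -normrM.
rewrite -subr_sqr !regabs_sqr.
rewrite (_ : _ - _ = (a - b) * (a + b)); last by ring.
rewrite normrM ler_wpM2l// (le_trans (ler_normD _ _))// lerD ?regabs_norm_le//.
Qed.

Lemma powR_lipschitz r C x y : 0 < x -> 0 < y ->
  (forall t, 0 < t -> Num.min x y <= t <= Num.max x y -> `|r * t `^ (r - 1)| <= C) ->
  `|x `^ r - y `^ r| <= C * `|x - y|.
Proof.
wlog xy : x y / x < y.
  move=> h x0 y0 tC; have [xy|yx|->] := ltgtP x y.
  - exact: h.
  - by rewrite distrC (distrC x); apply: h => // t; rewrite minC maxC; exact: tC.
  - by rewrite !subrr normr0 mulr0.
move=> x0 y0 tC; rewrite distrC (distrC x).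
have dE (t : R) : 0 < t -> is_derive t 1 (fun t : R => t `^ r) (r * t `^ (r - 1)).
  by move=> t0; exact: is_derive1_powR.
have [c /[!in_itv]/= /andP[xc cy] ->] :
    exists2 c, c \in `]x, y[%R & y `^ r - x `^ r = (r * c `^ (r - 1)) * (y - x).
  apply: (@MVT _ (fun t => t `^ r) (fun t => r * t `^ (r - 1))) => //.
    by move=> t /[!in_itv]/= /andP[xt _]; apply: dE; exact: lt_trans xt.
  apply: derivable_within_continuous => t /[!in_itv]/= /andP[xt _].
  by have [] := dE t (lt_le_trans x0 xt).
rewrite normrM ler_wpM2r// tC//; first exact: lt_trans xc.
by rewrite (min_l (ltW xy)) (max_r (ltW xy)) !ltW.
Qed.

Lemma powR_lipschitz_bounded q M x y : 1 <= q -> 0 < x <= M -> 0 < y <= M ->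
  `|x `^ q - y `^ q| <= q * M `^ (q - 1) * `|x - y|.
Proof.
move=> q1 /andP[x0 xM] /andP[y0 yM]; apply: powR_lipschitz => // t t0 /andP[_ tm].
have q0 : 0 <= q by lra.
rewrite ger0_norm ?mulr_ge0 ?powR_ge0// ler_wpM2l// ge0_ler_powR ?nnegrE ?(ltW t0)//.
- by rewrite subr_ge0.
- by rewrite (le_trans (ltW x0)).
- by rewrite (le_trans tm)// ge_max xM.
Qed.

Lemma powR_lipschitz_away q e x y : 1 <= q -> 0 < e -> e <= x -> e <= y ->
  `|x `^ (1 - q) - y `^ (1 - q)| <= (q - 1) * e `^ (- q) * `|x - y|.
Proof.
move=> q1 e0 ex ey; have x0 := lt_le_trans e0 ex; have y0 := lt_le_trans e0 ey.
apply: powR_lipschitz => // t t0 /andP[tm _].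
rewrite normrM (ger0_norm (powR_ge0 _ _)) distrC (ger0_norm (_ : 0 <= q - 1)); last lra.
apply: ler_wpM2l; first lra.
rewrite (_ : 1 - q - 1 = - q); last by ring.
rewrite !powRN lef_pV2 ?posrE ?powR_gt0// ge0_ler_powR ?nnegrE ?(ltW e0) ?(ltW t0)//.
  lra.
by rewrite (le_trans _ tm)// le_min ex.
Qed.

(** Subtracting the value at 0 makes this vanish at [a = 0], so that composing with [w] does not
    enlarge the support. *)
Definition regpow q e a := regabs e a `^ q - e `^ q.

Definition regquot q e c a := (regabs e a + c) `^ (1 - q).

Lemma regpow0 q e : 0 <= e -> regpow q e 0 = 0.
Proof. by move=> e0; rewrite /regpow regabs0// subrr. Qed.

Lemma regpow_bound q e M a : 0 <= q -> 0 <= e <= 1 -> `|a| <= M ->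
  0 <= regpow q e a <= (M + 1) `^ q.
Proof.
move=> q0 /andP[e0 e1] aM; have M0 := le_trans (normr_ge0 _) aM; apply/andP; split.
  by rewrite subr_ge0 ge0_ler_powR ?nnegrE ?regabs_ge0// regabs_ge.
apply: (@le_trans _ _ (regabs e a `^ q)); first by rewrite lerBlDr lerDl powR_ge0.
rewrite ge0_ler_powR ?nnegrE ?regabs_ge0 ?addr_ge0//.
by rewrite (le_trans (regabs_le a e0))// lerD.
Qed.

(** The constant must be independent of [e], which is later sent to 0; for [e <= 1] the smoothed
    moduli stay below [M + 1]. *)
Lemma regpow_lipschitz q e M a b : 1 <= q -> 0 < e <= 1 -> `|a| <= M -> `|b| <= M ->
  `|regpow q e a - regpow q e b| <= q * (M + 1) `^ (q - 1) * `|a - b|.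
Proof.
move=> q1 /andP[e0 e1] aM bM; 
have -> : regpow q e a - regpow q e b = regabs e a `^ q - regabs e b `^ q.
  by rewrite /regpow opprB addrA subrK.
have rb c : `|c| <= M -> 0 < regabs e c <= M + 1.
  move=> cM; rewrite (lt_le_trans e0) ?regabs_ge ?(ltW e0)//=.
  by rewrite (le_trans (regabs_le c (ltW e0)))// lerD.
apply: le_trans (powR_lipschitz_bounded q1 (rb a aM) (rb b bM)) _.
rewrite ler_wpM2l ?regabs_lipschitz// mulr_ge0 ?powR_ge0//; lra.
Qed.

Lemma regquot_bound q e c a : 1 <= q -> 0 < c -> 0 <= regquot q e c a <= c `^ (1 - q).
Proof.
move=> q1 c0; rewrite /regquot powR_ge0/=.
rewrite -(opprB q 1) !powRN lef_pV2 ?posrE ?powR_gt0 ?ltr_wpDl ?regabs_ge0//.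
apply: ge0_ler_powR; rewrite ?nnegrE ?lerDr ?regabs_ge0 ?(ltW c0)//; first lra.
by rewrite addr_ge0 ?regabs_ge0 ?ltW.
Qed.

Lemma regquot_lipschitz q e c a b : 1 <= q -> 0 < e -> 0 < c ->
  `|regquot q e c a - regquot q e c b| <= (q - 1) * c `^ (- q) * `|a - b|.
Proof.
move=> q1 e0 c0.
apply: le_trans (powR_lipschitz_away q1 c0 _ _) _; rewrite ?lerDr ?regabs_ge0//.
rewrite ler_wpM2l ?mulr_ge0 ?powR_ge0 ?subr_ge0//.
have -> : regabs e a + c - (regabs e b + c) = regabs e a - regabs e b by ring.
exact: regabs_lipschitz.
Qed.

Lemma regabs_cvg (e_ a_ : nat -> R) a : (forall k, 0 < e_ k) ->
  e_ k @[k --> \oo] --> 0 -> a_ k @[k --> \oo] --> a ->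
  regabs (e_ k) (a_ k) @[k --> \oo] --> `|a|.
Proof.
move=> e0 ce ca.
have na : `|a_ k| @[k --> \oo] --> `|a| by exact: cvg_norm.
apply: (@squeeze_cvgr _ _ _ _ (fun k => `|a_ k|) (fun k => `|a_ k| + e_ k)) => //.
  by apply: nearW => k; rewrite regabs_norm_le regabs_le// ltW.
by rewrite -[`|a|]addr0; exact: cvgD.
Qed.

Lemma regpow_cvg q (e_ : nat -> R) a : 0 < q -> (forall k, 0 < e_ k) ->
  e_ k @[k --> \oo] --> 0 -> regpow q (e_ k) a @[k --> \oo] --> `|a| `^ q.
Proof.
move=> q0 e0 ce.
have h : regabs (e_ k) a `^ q @[k --> \oo] --> `|a| `^ q.
  have -> : (fun k => regabs (e_ k) a `^ q) = (fun k => `|regabs (e_ k) a| `^ q).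
    by apply/funext => k; rewrite ger0_norm ?regabs_ge0.
  rewrite -[X in X `^ q]normr_id; apply: cvg_norm_powR => //.
  by apply: regabs_cvg => //; exact: cvg_cst.
have h' : e_ k `^ q @[k --> \oo] --> 0.
  have -> : (fun k => e_ k `^ q) = (fun k => `|e_ k| `^ q).
    by apply/funext => k; rewrite gtr0_norm.
  have -> : (0 : R) = `|0 : R| `^ q by rewrite normr0 powR0// gt_eqF.
  exact: cvg_norm_powR.
by rewrite -[X in _ --> X]subr0; exact: cvgB.
Qed.

Lemma regquot_cvg q (e_ a_ : nat -> R) c a : 1 <= q -> 0 < c -> (forall k, 0 < e_ k) ->
  e_ k @[k --> \oo] --> 0 -> a_ k @[k --> \oo] --> a ->
  regquot q (e_ k) c (a_ k) @[k --> \oo] --> (`|a| + c) `^ (1 - q).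
Proof.
move=> q1 c0 e0 ce ca; have h := regabs_cvg e0 ce ca.
have ac : 0 < `|a| + c by rewrite ltr_wpDl.
have hc : regabs (e_ k) (a_ k) + c @[k --> \oo] --> `|a| + c.
  by apply: cvgD => //; exact: cvg_cst.
have cP : {for `|a| + c, continuous (fun x : R => x `^ (1 - q))}.
  apply: differentiable_continuous; apply/derivable1_diffP.
  by have [] := @is_derive1_powR R (1 - q) _ ac.
exact: (@cvg_comp _ _ _ _ (fun x : R => x `^ (1 - q)) _ _ _ hc cP).
Qed.

End regularized_modulus.

(** * Membership of the quotient in the space *)

Section quotient.
Context {R : realType} {N : nat}.
Implicit Types (f g h u w : 'rV[R]_N -> R) (p q s c : R) (z : 'rV[R]_N * 'rV[R]_N)
  (Omega : set 'rV[R]_N).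
Local Notation leb := (@lebesgue_measure_rV R N).
Local Notation leb2 := (leb \x leb)%E.
Local Notation density s p f :=
  (fun z => (`|f z.1 - f z.2| `^ p * kernel s p z)%:E).

Lemma class_C_regabs k e f : 0 < e -> class_C k f ->
  class_C k (fun x => regabs e (f x)).
Proof.
move=> e0 Cf; apply: class_C_powR => [x|].
  by rewrite ltr_wpDl// -?expr2 ?sqr_ge0// exprn_gt0.
by apply: class_CD; [exact: class_CM|exact: class_C_cst].
Qed.

Lemma regabs_gt0 e (a : R) : 0 < e -> 0 < regabs e a.
Proof. by move=> e0; rewrite (lt_le_trans e0)// regabs_ge// ltW. Qed.

Lemma class_C_regpow k q e f : 0 < e -> class_C k f ->
  class_C k (fun x => regpow q e (f x)).
Proof.
move=> e0 Cf; apply: class_CD; last exact: class_C_cst.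
by apply: class_C_powR => [x|]; [exact: regabs_gt0|exact: class_C_regabs].
Qed.

Lemma class_C_regquot k q e c f : 0 < e -> 0 < c -> class_C k f ->
  class_C k (fun x => regquot q e c (f x)).
Proof.
move=> e0 c0 Cf; apply: class_C_powR => [x|].
  by rewrite addr_gt0// regabs_gt0.
by apply: class_CD; [exact: class_C_regabs|exact: class_C_cst].
Qed.

Lemma test_function_support Omega w f : test_function Omega w ->
  (forall k, class_C k f) -> (forall x, w x = 0 -> f x = 0) -> test_function Omega f.
Proof.
move=> [_ cw sw] Cf fw.
have sub : closure [set x | f x != 0] `<=` closure [set x | w x != 0].
  by apply: closure_subset => x /= fx; apply: contra_neq fx => /fw.
split => //; last exact: subset_trans sub sw.
by apply: subclosed_compact cw sub; exact: closed_closure.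
Qed.

Lemma density_le s p C f g h z : 0 < p -> 0 <= C ->
  `|f z.1 - f z.2| <= C * (`|g z.1 - g z.2| + `|h z.1 - h z.2|) ->
  (density s p f z <= (C `^ p)%:E *
    ((2 `^ p)%:E * (density s p g z + density s p h z)))%E.
Proof.
move=> p0 C0 fgh; rewrite -EFinD -!EFinM lee_fin -mulrDl !mulrA.
rewrite ler_wpM2r ?kernel_ge0//.
apply: (@le_trans _ _ ((C * (`|g z.1 - g z.2| + `|h z.1 - h z.2|)) `^ p)).
  by rewrite ge0_ler_powR ?nnegrE ?mulr_ge0 ?addr_ge0// ltW.
rewrite powRM ?addr_ge0// -mulrA ler_wpM2l ?powR_ge0//.
exact: powRD_le (ltW p0) (normr_ge0 _) (normr_ge0 _).
Qed.

Definition quotient q c w u x : R := `|w x| `^ q * (`|u x| + c) `^ (1 - q).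

Lemma measurable_quotient q c w u : measurable_fun setT w -> measurable_fun setT u ->
  measurable_fun setT (quotient q c w u).
Proof.
move=> mw mu; apply: measurable_funM.
  exact: measurable_norm_powR.
apply: (measurableT_comp (measurable_powR _)); apply: measurable_funD.
  exact: (measurableT_comp (@normr_measurable _ _)).
exact: measurable_cst.
Qed.

(* The quotient is approximated by smoothing both absolute values in
   [|w|^q (|u| + c)^(1 - q)] and replacing [u] by test functions; these
   functions of [(w, u)] are Lipschitz uniformly in the smoothing. *)
Lemma W0_quotient s p q c Omega u w : 1 < p -> 0 < s < 1 -> 1 < q -> 0 < c ->
  ~ {ae leb, forall x, Omega x} -> W0 s p Omega u -> test_function Omega w ->
  W0 s p Omega (quotient q c w u).
Proof.
move=> p1 s01 q1 c0 nO Wu tw; have p0 : 0 < p by lra.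
have q0 : 0 < q by lra.
have [mu u0 _] := Wu; have [phi [tphi ephi]] := W0_approx p0 Wu.
have mw := test_function_measurable tw.
have [M wM] := test_function_bounded tw.
have M0 : 0 <= M := le_trans (normr_ge0 _) (wM 0).
pose e_ k : R := k.+1%:R^-1.
have e0 k : 0 < e_ k by rewrite invr_gt0.
have e1 k : e_ k <= 1 by rewrite invf_le1// ler1n.
have ce : e_ k @[k --> \oo] --> 0 by exact: cvg_harmonic.
pose psi k x := regpow q (e_ k) (w x) * regquot q (e_ k) c (phi k x).
have tpsi k : test_function Omega (psi k).
  apply: (test_function_support tw) => [j|x wx].
    have [Cw _ _] := tw; have [Cp _ _] := tphi k.
    by apply: class_CM; [exact: class_C_regpow|exact: class_C_regquot].
  by rewrite /psi wx regpow0 ?mul0r// ltW.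
have w_off x : ~ Omega x -> w x = 0.
  move=> nOx; apply/eqP/negPn/negP => wx; apply: nOx.
  by have [_ _] := tw; apply; exact: subset_closure.
have [A A0 lipA] : exists2 A, 0 <= A & forall k x y,
    `|regpow q (e_ k) (w x) - regpow q (e_ k) (w y)| <= A * `|w x - w y|.
  exists (q * (M + 1) `^ (q - 1)); first by rewrite mulr_ge0 ?powR_ge0// ltW.
  by move=> k x y; apply: regpow_lipschitz; rewrite ?(ltW q1) ?e0 ?e1.
(* The two entries belong to the terms [(a1 - a2) * b1] and [a2 * (b1 - b2)] of the product
   difference below: the Lipschitz constant of one factor times a bound for the other. *)
pose C := Num.max (A * c `^ (1 - q)) ((M + 1) `^ q * ((q - 1) * c `^ (- q))).
have C0 : 0 <= C by rewrite le_max mulr_ge0 ?powR_ge0.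
have psi_lip k z :
    `|psi k z.1 - psi k z.2| <= C * (`|w z.1 - w z.2| + `|phi k z.1 - phi k z.2|).
  rewrite /psi; set a1 := regpow _ _ _; set a2 := regpow _ _ (w z.2).
  set b1 := regquot _ _ _ _; set b2 := regquot _ _ _ (phi k z.2).
  rewrite (_ : a1 * b1 - a2 * b2 = (a1 - a2) * b1 + a2 * (b1 - b2)); last by ring.
  apply: (le_trans (ler_normD _ _)); rewrite [leRHS]mulrDr; apply: lerD; rewrite normrM.
    have /andP[b10 b1c] := regquot_bound (e_ k) (phi k z.1) (ltW q1) c0.
    apply: (@le_trans _ _ (A * `|w z.1 - w z.2| * c `^ (1 - q))).
      by apply: ler_pM => //; [exact: lipA|rewrite ger0_norm].
    by rewrite mulrAC ler_wpM2r// le_max lexx.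
  have e01 : 0 <= e_ k <= 1 by rewrite ltW//= e1.
  have /andP[a20 a2M] := regpow_bound (ltW q0) e01 (wM z.2).
  apply: (@le_trans _ _ ((M + 1) `^ q *
      ((q - 1) * c `^ (- q) * `|phi k z.1 - phi k z.2|))).
    apply: ler_pM => //; first by rewrite ger0_norm.
    exact: regquot_lipschitz (ltW q1) (e0 k) c0.
  by rewrite mulrA ler_wpM2r// le_max lexx orbT.
have mpsi k := test_function_measurable (tpsi k).
have mQ : measurable_fun setT (quotient q c w u) by exact: measurable_quotient.
(* A majorant for all [psi k] at once: the density of [phi k] is replaced by its bound from
   [approx_density_le], which is free of [k]. *)
pose g z : \bar R := ((C `^ p)%:E * ((2 `^ p)%:E * (density s p w z +
  (2 `^ p)%:E * (density s p u z + defect s p u phi z))))%E.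
have ig : leb2.-integrable setT g.
  apply: integrableZl => //; apply: integrableZl => //; apply: integrableD => //.
    by apply: integrable_density => //; exact: test_function_energy tw.
  apply: integrableZl => //; apply: integrableD => //.
    by apply: integrable_density => //; exact: W0_energy_lty Wu.
  exact: (integrable_defect mu tphi ephi).
have psi_g k z : (density s p (psi k) z <= g z)%E.
  apply: le_trans (density_le s p0 C0 (psi_lip k z)) _.
  rewrite lee_wpmul2l ?lee_fin ?powR_ge0// lee_wpmul2l ?lee_fin ?powR_ge0//.
  by rewrite leeD2l//; apply: approx_density_le.
(* The quotient depends on the values of [u] and not only on its differences, so [ae_cvg] is used
   here rather than [ae_diff_cvg]. *)
have cpsi : {ae leb, forall x, psi k x @[k --> \oo] --> quotient q c w u x}.
  apply: filterS (ae_cvg p1 mu tphi ephi nO u0) => x cx.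
  by apply: cvgM; [exact: regpow_cvg|apply: regquot_cvg => //; exact: ltW].
split => //.
  by apply: nearW => x /w_off wx; rewrite /quotient wx normr0 powR0 ?mul0r// gt_eqF.
exists psi; split => //.
have cpsi2 : {ae leb2, forall z, psi k z.1 - psi k z.2 @[k --> \oo] -->
    quotient q c w u z.1 - quotient q c w u z.2}.
  apply: (filterS2 _ _ (ae_prod_fst leb cpsi) (ae_prod_snd leb cpsi)) => z h1 h2.
  exact: cvgB.
have [_] := energy_dominated p0 mpsi mQ ig psi_g cpsi2.
have p10 : 0 < p^-1 by rewrite invr_gt0.
by move/(poweR_cvg0 p10 (fun k => energy_ge0 _ _ _)).
Qed.

End quotient.

(** * The key inequality *)

Section fatou_limits.
Context d (T : measurableType d) (R : realType) (mu : {measure set T -> \bar R}).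

Lemma fatou_cvg (D : set T) (f_ : nat -> T -> \bar R) (f : T -> \bar R)
    (b : nat -> \bar R) (B : \bar R) :
  measurable D -> (forall k, measurable_fun D (f_ k)) ->
  (forall k x, D x -> 0 <= f_ k x)%E ->
  measurable_fun D f -> {ae mu, forall x, D x -> f_ k x @[k --> \oo] --> f x} ->
  (forall k, (\int[mu]_(x in D) f_ k x <= b k)%E) -> b k @[k --> \oo] --> B ->
  (\int[mu]_(x in D) f x <= B)%E.
Proof.
move=> mD mf_ f_0 mf cf fb cb.
have mli : measurable_fun D (fun x => limn_einf (f_^~ x)).
  rewrite /limn_einf; apply: measurableT_comp => //.
  by apply: measurable_fun_limn_esup => k; exact: measurableT_comp.
have -> : (\int[mu]_(x in D) f x = \int[mu]_(x in D) limn_einf (f_^~ x))%E.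
  apply: ae_eq_integral => //; apply: filterS cf => x cfx Dx.
  by rewrite (cvg_limn_einf_sup (cfx Dx)).1.
apply: le_trans (fatou mu mD mf_ f_0) _; rewrite limn_einf_lim -(cvg_lim _ cb)//.
apply: lee_lim; [exact: is_cvg_einfs|by apply/cvg_ex; exists B|].
apply: nearW => k; apply: le_trans (fb k).
by apply: ereal_inf_lbound; exists k => /=.
Qed.

(** The majorant makes the integral of [g^\+] finite, and nonnegativity of the integral of [g] then
    bounds that of [g^\-] by it. The bound on the negative part is what later excludes blow-up on a
    set of positive measure. *)
Lemma integral_pos_neg_bound (g : T -> \bar R) (h : T -> \bar R) :
  measurable_fun setT g -> measurable_fun setT h -> (forall x, 0 <= h x)%E ->
  (\int[mu]_x h x < +oo)%E -> {ae mu, forall x, (g x <= h x)%E} ->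
  (0 <= \int[mu]_x g x)%E ->
  (\int[mu]_x g x <= \int[mu]_x h x)%E /\ (\int[mu]_x g^\- x <= \int[mu]_x h x)%E.
Proof.
move=> mg mh h0 hoo gh g0.
have gp : (\int[mu]_x g^\+ x <= \int[mu]_x h x)%E.
  apply: ae_ge0_le_integral => //; first exact: measurable_funepos.
  apply: filterS gh => x gx _; rewrite funeposE.
  by rewrite ge_max gx/=.
have gp0 : (0 <= \int[mu]_x g^\+ x)%E by apply: integral_ge0 => x _; exact: funepos_ge0.
have gn0 : (0 <= \int[mu]_x g^\- x)%E by apply: integral_ge0 => x _; exact: funeneg_ge0.
have gpf : (\int[mu]_x g^\+ x)%E \is a fin_num.
  by rewrite ge0_fin_numE//; exact: le_lt_trans gp hoo.
move: g0; rewrite integralE sube_ge0 ?gpf ?orbT// => gng; split.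
  by apply: le_trans gp; rewrite -[leRHS]sube0; exact: leeB.
exact: le_trans gng gp.
Qed.

End fatou_limits.

Lemma measurable_spow (R : realType) (r : R) : measurable_fun setT (spow r).
Proof.
apply: measurable_funM => //; apply: (measurableT_comp (measurable_powR _)).
exact: normr_measurable.
Qed.

Section key_inequality.
Context {R : realType} {N : nat}.
Implicit Types (f g h w : 'rV[R]_N -> R) (c : R) (z : 'rV[R]_N * 'rV[R]_N).
Variables (Omega : set 'rV[R]_N) (s p q lambda : R) (u : 'rV[R]_N -> R).
Local Notation leb := (@lebesgue_measure_rV R N).
Local Notation leb2 := (leb \x leb)%E.
Local Notation density f :=
  (fun z => (`|f z.1 - f z.2| `^ p * kernel s p z)%:E).
Hypotheses (mOmega : measurable Omega)
  (nOmega : ~ {ae leb, forall x, Omega x}) (p1 : 1 < p) (s01 : 0 < s < 1)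
  (qp : 1 < q <= p) (lambda0 : 0 < lambda)
  (u_nontrivial : ~ {ae leb, forall x, u x = 0})
  (u_ge0 : {ae leb, forall x, Omega x -> 0 <= u x})
  (u_sol : weak_solution s p q Omega lambda u).

Let p0 : 0 < p. Proof. exact: lt_trans p1. Qed.
Let q1 : 1 < q. Proof. by case/andP: qp. Qed.
Let q0 : 0 < q. Proof. exact: lt_trans q1. Qed.
Let pq01 : 0 <= q / p <= 1.
Proof.
by case/andP: qp => _ qlp; rewrite ler_pdivrMr// mul1r qlp divr_ge0// ltW.
Qed.

Let Wu : W0 s p Omega u. Proof. by case: u_sol. Qed.
Let mu : measurable_fun setT u. Proof. by case: Wu. Qed.
Let eu : (energy s p u < +oo)%E. Proof. exact: W0_energy_lty Wu. Qed.

Let ae_u_ge0 : {ae leb, forall x, 0 <= u x}.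
Proof.
have [_ u0 _] := Wu; apply: (filterS2 _ _ u_ge0 u0) => x ux nx.
by have [/ux|/nx ->] := pselect (Omega x).
Qed.

(** The weak equation tested with [u] itself. *)
Lemma weak_solution_energy :
  energy s p u = (lambda%:E * \int[leb]_(x in Omega) (`|u x| `^ q)%:E)%E.
Proof.
have [_ /(_ _ Wu) usol] := u_sol.
rewrite (_ : (\int[leb]_(x in Omega) (`|u x| `^ q)%:E =
  \int[leb]_(x in Omega) (spow q (u x) * u x)%:E)%E); last first.
  by apply: eq_integral => x _; rewrite spow_mul// gt_eqF.
rewrite -usol; apply: eq_integral => z _; congr EFin.
by rewrite mulrAC spow_mul// gt_eqF.
Qed.

(** * The key inequality for a test function *)

Section test.
Variable w : 'rV[R]_N -> R.
Hypothesis tw : test_function Omega w.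

Let mw : measurable_fun setT w. Proof. exact: test_function_measurable tw. Qed.

Let ew : (energy s p w < +oo)%E. Proof. exact: test_function_energy tw. Qed.

Let H z : \bar R := ((q / p)%:E * density w z + (1 - q / p)%:E * density u z)%E.

Let B : \bar R := ((q / p)%:E * energy s p w + (1 - q / p)%:E * energy s p u)%E.

Let H_ge0 z : (0 <= H z)%E.
Proof.
case/andP: pq01 => h0 h1; rewrite adde_ge0// mule_ge0 ?lee_fin ?energy_density_ge0//.
by rewrite subr_ge0.
Qed.

Let mH : measurable_fun setT H.
Proof.
by apply: emeasurable_funD; apply: emeasurable_funM => //;
  (exact: measurable_cst || exact: measurable_density).
Qed.

Let integral_H : (\int[leb2]_z H z = B)%E.
Proof.
case/andP: pq01 => h0 h1.
have d0 f z : (0 <= density f z)%E by rewrite lee_fin energy_density_ge0.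
have md f : measurable_fun setT f -> measurable_fun setT (density f).
  exact: measurable_density.
rewrite ge0_integralD//.
- congr (_ + _)%E; apply: ge0_integralZl => //; try exact: md.
  by rewrite lee_fin subr_ge0.
- by move=> z _; rewrite mule_ge0.
- by apply: emeasurable_funM; [exact: measurable_cst|exact: md].
- by move=> z _; rewrite mule_ge0// lee_fin subr_ge0.
- by apply: emeasurable_funM; [exact: measurable_cst|exact: md].
Qed.

Let B_lty : (B < +oo)%E.
Proof.
have uf : energy s p u \is a fin_num.
  by rewrite ge0_fin_numE; [exact: eu|exact: energy_ge0].
have wf : energy s p w \is a fin_num.
  by rewrite ge0_fin_numE; [exact: ew|exact: energy_ge0].
by rewrite /B -(fineK uf) -(fineK wf) -!EFinM -EFinD ltry.
Qed.

Let psi c := quotient q c w u.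

Let G c z : \bar R :=
  (spow p (u z.1 - u z.2) * kernel s p z * (psi c z.1 - psi c z.2))%:E.

(** The right-hand integrand with [spow q (u x)] replaced by a power of [|u x|]. The two agree
    wherever [u x >= 0], including zeros since [q > 1], and this form is nonnegative everywhere, as
    Fatou's lemma requires. *)
Let J c x : \bar R := (`|u x| `^ (q - 1) * psi c x)%:E.

Let mpsi c : measurable_fun setT (psi c).
Proof. exact: measurable_quotient. Qed.

Let mG c : measurable_fun setT (G c).
Proof.
apply/measurable_EFinP; apply: measurable_funM; last exact: measurable_diff.
apply: measurable_funM; last exact: measurable_kernel.
apply: measurable_funM; last exact: measurable_diff.
by apply: measurable_norm_powR; exact: measurable_diff.
Qed.

Let mJ c : measurable_fun setT (J c).
Proof.
apply/measurable_EFinP; apply: measurable_funM => //.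
exact: measurable_norm_powR.
Qed.

Let J_ge0 c x : (0 <= J c x)%E.
Proof. by rewrite lee_fin !mulr_ge0 ?powR_ge0. Qed.

Let integral_G c : 0 < c ->
  (\int[leb2]_z G c z = lambda%:E * \int[leb]_(x in Omega) J c x)%E.
Proof.
move=> c0; have [_ usol] := u_sol.
have /usol -> := W0_quotient p1 s01 q1 c0 nOmega Wu tw.
congr (_ * _)%E; apply: ae_eq_integral => //.
- apply: measurable_funTS; apply/measurable_EFinP; apply: measurable_funM; last exact: mpsi.
  exact: (measurableT_comp (measurable_spow q)).
- exact: measurable_funTS.
- apply: filterS ae_u_ge0 => x ux _; rewrite /J; congr (_ * _)%:E.
  have [->|ux0] := eqVneq (u x) 0.
    by rewrite spow0 normr0 powR0// gt_eqF// subr_gt0.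
  by rewrite spow_gt0 ?lt_def ?ux0// ger0_norm.
Qed.

Let G_le_H c : 0 < c -> {ae leb2, forall z, (G c z <= H z)%E}.
Proof.
move=> c0.
apply: (filterS2 _ _ (ae_prod_fst leb ae_u_ge0) (ae_prod_snd leb ae_u_ge0)) => z z1 z2.
rewrite /G /H -!EFinM -EFinD lee_fin.
rewrite mulrAC !mulrA -mulrDl ler_wpM2r ?kernel_ge0//.
rewrite /psi /quotient (ger0_norm z1) (ger0_norm z2).
(* The shift leaves the difference unchanged and makes both arguments positive, as [picone]
   demands. *)
rewrite (_ : u z.1 - u z.2 = (u z.1 + c) - (u z.2 + c)); last by ring.
apply: le_trans (picone qp (normr_ge0 _) (normr_ge0 _) _ _) _.
- by rewrite ltr_wpDl.
- by rewrite ltr_wpDl.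
case/andP: pq01 => h0 h1; rewrite lerD2r ler_wpM2l// ge0_ler_powR ?nnegrE ?(ltW p0)//.
exact: ler_dist_dist.
Qed.

Let integral_bounds c : 0 < c ->
  (lambda%:E * \int[leb]_(x in Omega) J c x <= B)%E /\
  (\int[leb2]_z (G c)^\- z <= B)%E.
Proof.
move=> c0; rewrite -integral_G// -integral_H; apply: integral_pos_neg_bound => //.
- by rewrite integral_H.
- exact: G_le_H.
- rewrite integral_G// mule_ge0 ?lee_fin ?(ltW lambda0)//.
  by apply: integral_ge0 => x _; exact: J_ge0.
Qed.

Let c_ k : R := k.+1%:R^-1.
Let c_gt0 k : 0 < c_ k. Proof. by rewrite invr_gt0. Qed.

Let cvg_c_ : c_ k @[k --> \oo] --> 0.
Proof. exact: cvg_harmonic. Qed.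

Let c_powE k : c_ k `^ (1 - q) = k.+1%:R `^ (q - 1).
Proof. by rewrite /c_ -powR_inv1// -powRrM mulN1r opprB. Qed.

Let E : set ('rV[R]_N * 'rV[R]_N) :=
  [set z | [/\ u z.1 = 0, w z.1 != 0 & 0 < u z.2]].

Let mE : measurable E.
Proof.
rewrite (_ : E = fst @^-1` (u @^-1` [set 0]) `&` (fst @^-1` (w @^-1` [set~ 0])
    `&` snd @^-1` (u @^-1` `]0, +oo[%classic))).
  have pre (f : 'rV[R]_N -> R) (A : set R) : measurable_fun setT f ->
      measurable A -> measurable (f @^-1` A).
    by move=> mf mA; rewrite -[X in measurable X]setTI; exact: mf.
  apply: measurableI; last apply: measurableI.
  - by rewrite -[X in measurable X]setTI; apply: measurable_fst => //; exact: pre.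
  - rewrite -[X in measurable X]setTI; apply: measurable_fst => //.
    by apply: pre => //; exact: measurableC.
  - by rewrite -[X in measurable X]setTI; apply: measurable_snd => //; exact: pre.
apply/seteqP; split => z /=; rewrite in_itv/= andbT.
  by move=> [h1 h2 h3]; split => //; split => //; exact/eqP.
by move=> [h1 [h2 h3]]; split => //; exact/eqP.
Qed.

(** At a zero of [u] the quotient is [|w z.1|^q * c^(1 - q)], which is unbounded as [c] tends to 0,
    while at [z.2] it stays below [|w z.2|^q * (u z.2)^(1 - q)]. *)
Let G_blowup z : E z -> ((G (c_ k))^\- z)%E @[k --> \oo] --> +oo%E.
Proof.
move=> [u1 w1 u2]; apply/cvgeyPge => A.
have z12 : z.1 != z.2 by apply/eqP => z12; move: u2; rewrite -z12 u1 ltxx.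
set K := u z.2 `^ (p - 1) * kernel s p z.
have K0 : 0 < K by apply: mulr_gt0; [exact: powR_gt0|exact: (kernel_gt0 s p z12)].
have P0 : 0 < K * `|w z.1| `^ q by rewrite mulr_gt0// powR_gt0// normr_gt0.
set Q := K * (`|w z.2| `^ q * u z.2 `^ (1 - q)).
(* [X] is the size that [c_ k]^ (1 - q)[must reach for the negative part to
   exceed]A[; as this power equals]k.+1%:R [^ (q - 1)], it suffices that [k] be at least the
   [(q - 1)]-th root of [X]. *)
pose X := `|(A + Q) / (K * `|w z.1| `^ q)|.
have qm1 : 0 < q - 1 by rewrite subr_gt0.
have : \forall k \near \oo, X `^ (q - 1)^-1 <= k%:R by exact: nbhs_infty_ger.
apply: filterS => k kX.
have Xk : X <= c_ k `^ (1 - q).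
  rewrite c_powE; have -> : X = (X `^ (q - 1)^-1) `^ (q - 1).
    by rewrite -powRrM mulVf ?gt_eqF// powRr1// /X.
  rewrite ge0_ler_powR ?nnegrE ?powR_ge0 ?(ltW qm1)//.
  by rewrite (le_trans kX)// ler_nat.
have GE : G (c_ k) z = (- (K * (`|w z.1| `^ q * c_ k `^ (1 - q) -
    `|w z.2| `^ q * (u z.2 + c_ k) `^ (1 - q))))%:E.
  rewrite /G u1 sub0r spowN spow_gt0// /psi /quotient u1 normr0 add0r (gtr0_norm u2).
  by rewrite /K !mulNr.
rewrite funenegE GE -EFinN opprK le_max lee_fin; apply/orP; left.
have -> : K * (`|w z.1| `^ q * c_ k `^ (1 - q) -
    `|w z.2| `^ q * (u z.2 + c_ k) `^ (1 - q)) =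
    K * `|w z.1| `^ q * c_ k `^ (1 - q) -
    K * (`|w z.2| `^ q * (u z.2 + c_ k) `^ (1 - q)) by rewrite mulrBr !mulrA.
rewrite lerBrDr; apply: (@le_trans _ _ (A + Q)).
  rewrite lerD2l ler_wpM2l ?(ltW K0)// ler_wpM2l ?powR_ge0//.
  rewrite -opprB !powRN lef_pV2 ?posrE ?powR_gt0 ?addr_gt0//.
  by rewrite ge0_ler_powR ?nnegrE ?lerDl ?(ltW qm1) ?addr_ge0// ltW.
rewrite mulrC -ler_pdivrMr//; apply: le_trans Xk; exact: ler_norm.
Qed.

Let E_null : {ae leb2, forall z, ~ E z}.
Proof.
(* The bound [B] on the negative parts does not depend on [c], so Fatou's lemma carries it to the
   infinite limit, and a finite [B] forces [E] to be null. *)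
have : (\int[leb2]_(z in E) cst +oo z <= B)%E.
  have h := @fatou_cvg _ _ _ leb2 E (fun k => (G (c_ k))^\-%E) (cst +oo%E) (cst B).
  apply: h => //.
  - by move=> k; apply: measurable_funTS; exact: measurable_funeneg.
  - by apply: nearW => z Ez; exact: G_blowup.
  - move=> k; apply: le_trans (integral_bounds (c_gt0 k)).2.
    by apply: ge0_subset_integral => //; exact: measurable_funeneg.
  - exact: cvg_cst.
rewrite integral_cst// => /le_lt_trans/(_ B_lty).
have [E0 _|E0] := eqVneq (leb2 E) 0%E; last first.
  by rewrite gt0_mulye// lt0e E0 measure_ge0.
exists E; split => // z /= nEz; exact: contrapT.
Qed.

(** If [u x = 0] and [w x] is nonzero, the section of [E] at [x] is the set where [u] is positive.
    For almost every [x] it is null, which would make [u] trivial. *)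
Let ae_test_vanish : {ae leb, forall x, u x = 0 -> w x = 0}.
Proof.
apply: filterS (ae_xsection E_null) => x nE ux; apply: contrapT => /eqP wx.
apply: u_nontrivial; apply: (filterS2 _ _ nE ae_u_ge0) => y nEy uy.
apply: contrapT => /eqP uy0; apply: nEy; split => //=.
by rewrite lt_def uy0.
Qed.

Lemma test_function_key_inequality :
  (lambda%:E * \int[leb]_(x in Omega) (`|w x| `^ q)%:E <=
    (q / p)%:E * energy s p w + (1 - q / p)%:E * energy s p u)%E.
Proof.
have mwq : measurable_fun Omega (fun x => (`|w x| `^ q)%:E).
  by apply: measurable_funTS; apply/measurable_EFinP; exact: measurable_norm_powR.
rewrite -ge0_integralZl//; last by rewrite lee_fin ltW.
apply: (@fatou_cvg _ _ _ leb Omega (fun k x => (lambda%:E * J (c_ k) x)%E) _ (cst B)) => //.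
- by move=> k; apply: emeasurable_funM; [exact: measurable_cst|exact: measurable_funTS].
- by move=> k x _; rewrite mule_ge0// lee_fin ltW.
- by apply: emeasurable_funM; first exact: measurable_cst.
- apply: filterS ae_test_vanish => x wx _.
  rewrite /J -EFinM; under eq_fun do rewrite -EFinM.
  apply: cvg_EFin; first exact: nearW.
  apply: cvgM; first exact: cvg_cst.
  (* At a zero of [u] the integrand is 0 for every [k], so the limit is right only because [w x = 0]
     there. Elsewhere the powers [q - 1] and [1 - q] of [|u x|] cancel in the limit. *)
  rewrite /psi /quotient; have [ux|ux] := eqVneq (u x) 0.
    rewrite (wx ux) ux !normr0 (powR0 (x := q)) ?gt_eqF//.
    under eq_fun do rewrite mul0r mulr0; exact: cvg_cst.
  have ux0 : 0 < `|u x| by rewrite normr_gt0.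
  have wE : `|w x| `^ q = `|u x| `^ (q - 1) * (`|w x| `^ q * `|u x| `^ (1 - q)).
    rewrite mulrCA -powRD_gt0// (_ : q - 1 + (1 - q) = 0) ?powRr0 ?mulr1//; ring.
  rewrite [X in _ --> X]wE.
  apply: cvgM; first exact: cvg_cst.
  apply: cvgM; first exact: cvg_cst.
  have hc : `|u x| + c_ k @[k --> \oo] --> `|u x|.
    by rewrite -[X in _ --> X]addr0; apply: cvgD; [exact: cvg_cst|exact: cvg_c_].
  have cP : {for `|u x|, continuous (fun y : R => y `^ (1 - q))}.
    apply: differentiable_continuous; apply/derivable1_diffP.
    by have [] := @is_derive1_powR R (1 - q) _ ux0.
  exact: (@cvg_comp _ _ _ _ (fun y : R => y `^ (1 - q)) _ _ _ hc cP).
- move=> k; rewrite ge0_integralZl//; last by rewrite lee_fin ltW.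
    exact: (integral_bounds (c_gt0 k)).1.
  exact: measurable_funTS.
- exact: cvg_cst.
Qed.

End test.

(** On the left, a.e. convergence of the approximants and Fatou's lemma suffice because the
    inequality points the right way; on the right the energies converge. *)
Lemma key_inequality w : W0 s p Omega w ->
  (lambda%:E * \int[leb]_(x in Omega) (`|w x| `^ q)%:E <=
    (q / p)%:E * energy s p w + (1 - q / p)%:E * energy s p u)%E.
Proof.
move=> Ww; have [mw w0 _] := Ww; have [phi [tphi ephi]] := W0_approx p0 Ww.
have mq f : measurable_fun setT f -> measurable_fun Omega (fun x => (`|f x| `^ q)%:E).
  move=> mf; apply: measurable_funTS; apply/measurable_EFinP.
  exact: measurable_norm_powR.
have mphi k := test_function_measurable (tphi k).
have ew : (energy s p w < +oo)%E := W0_energy_lty p1 s01 Ww.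
rewrite -ge0_integralZl//; last 2 first.
- exact: mq.
- by rewrite lee_fin ltW.
apply: (@fatou_cvg _ _ _ leb Omega
  (fun k x => (lambda%:E * (`|phi k x| `^ q)%:E)%E) _
  (fun k => (q / p)%:E * energy s p (phi k) + (1 - q / p)%:E * energy s p u)%E) => //.
- by move=> k; apply: emeasurable_funM; [exact: measurable_cst|exact: mq].
- by move=> k x _; rewrite mule_ge0// lee_fin ?powR_ge0// ltW.
- by apply: emeasurable_funM; [exact: measurable_cst|exact: mq].
- apply: filterS (ae_cvg p1 mw tphi ephi nOmega w0) => x cx _.
  apply: cvgeZl => //; apply: cvg_EFin; first exact: nearW.
  exact: cvg_norm_powR.
- move=> k; rewrite ge0_integralZl//; last 2 first.
  + exact: mq.
  + by rewrite lee_fin ltW.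
  exact: test_function_key_inequality.
- have fin f : (energy s p f < +oo)%E -> energy s p f \is a fin_num.
    by move=> ef; rewrite ge0_fin_numE; [exact: ef|exact: energy_ge0].
  apply: cvgeD; last exact: cvg_cst.
    by rewrite fin_num_adde_defl// fin_numM// fin.
  by apply: cvgeZl => //; exact: approx_energy_cvg mw tphi ephi.
Qed.

End key_inequality.

(** * Conclusion *)

Section scaling.
Context {R : realType} {N : nat}.
Implicit Types (f u : 'rV[R]_N -> R) (c p q s : R) (Omega : set 'rV[R]_N).
Local Notation leb := (@lebesgue_measure_rV R N).

Lemma W0Z s p Omega u c : 0 < p -> W0 s p Omega u -> W0 s p Omega (fun x => c * u x).
Proof.
move=> p0 Wu; have [mu u0 _] := Wu; have [phi [tphi ephi]] := W0_approx p0 Wu.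
split.
- exact: measurable_funM.
- by apply: filterS u0 => x ux /ux ->; rewrite mulr0.
exists (fun k x => c * phi k x); split => [k|].
  apply: (test_function_support (tphi k)) => [j|x ->]; last by rewrite mulr0.
  by have [Cphi _ _] := tphi k; apply: class_CM => //; exact: class_C_cst.
have p10 : 0 < p^-1 by rewrite invr_gt0.
apply: (poweR_cvg0 p10 (fun k => energy_ge0 _ _ _)).
have E k : energy s p (fun x => c * phi k x - c * u x) =
    ((`|c| `^ p)%:E * energy s p (fun x => (phi k x - u x)%R))%E.
  transitivity (energy s p (fun x => c * (phi k x - u x))).
    by congr (energy _ _ _); apply/funext => x; rewrite mulrBr.
  apply: (energyZ s (f := fun x => phi k x - u x)) => //.
  by apply: measurable_funB => //; exact: test_function_measurable (tphi k).
have b0 : (`|c| `^ p * 2^-1 ^+ k)%:E @[k --> \oo] --> 0%E.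
  apply: cvg_EFin; first exact: nearW.
  rewrite -[X in _ --> X](mulr0 (`|c| `^ p)); apply: cvgM; first exact: cvg_cst.
  by apply: cvg_expr; rewrite gtr0_norm ?invr_gt0// invf_lt1// ltr1n.
apply: cvge0_le b0 => k; rewrite energy_ge0/= E EFinM lee_wpmul2l//.
Qed.

Lemma LqnormE q Omega f : q != 0 -> measurable Omega ->
  Lqnorm q Omega f = ((\int[leb]_(x in Omega) (`|f x| `^ q)%:E) `^ q^-1)%E.
Proof.
move=> q0 mO; rewrite /Lqnorm unlock [in RHS]integral_mkcond.
congr (_ `^ _)%E; apply: eq_integral => x _ /=; rewrite /patch.
by case: ifPn => _ //=; rewrite normr0 powR0.
Qed.

Lemma integral_powZ q Omega f c : measurable Omega -> measurable_fun setT f ->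
  (\int[leb]_(x in Omega) (`|c * f x| `^ q)%:E =
   (`|c| `^ q)%:E * \int[leb]_(x in Omega) (`|f x| `^ q)%:E)%E.
Proof.
move=> mO mf.
transitivity (\int[leb]_(x in Omega) ((`|c| `^ q)%:E * (`|f x| `^ q)%:E))%E.
  by apply: eq_integral => x _; rewrite normrM powRM.
apply: ge0_integralZl => //.
by apply: measurable_funTS; apply/measurable_EFinP; exact: measurable_norm_powR.
Qed.

End scaling.

Theorem theorem6p1 (R : realType) (N : nat) (hN : (0 < N)%N)
    (Omega : set 'rV[R]_N) (Omega_open : open Omega)
    (Omega_bounded : bounded_set Omega) (Omega_connected : connected Omega)
    (p s q : R) (hp : 1 < p) (hs : 0 < s < 1) (hq : 1 < q <= p)
    (lambda : R) (hlambda : 0 < lambda) (u : 'rV[R]_N -> R)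
    (u_nontrivial : ~ {ae lebesgue_measure_rV N, forall x, u x = 0})
    (u_ge0 : {ae lebesgue_measure_rV N, forall x, Omega x -> 0 <= u x})
    (u_sol : weak_solution s p q Omega lambda u) :
  (lambda%:E * (\int[lebesgue_measure_rV N]_(x in Omega) (`|u x| `^ q)%:E)
     `^ ((q - p) / q))%E = lambda_spq s p q Omega /\
  is_minimizer s p q Omega (fun x => u x * (fine (Lqnorm q Omega u))^-1).
Proof.
have mO : measurable Omega by exact: open_measurable_row.
have nO := bounded_complement_nonnull hN Omega_bounded.
have p0 : 0 < p by exact: lt_trans hp.
have q0 : 0 < q by case/andP: hq => q1 _; exact: lt_trans q1.
have qn0 : q != 0 by rewrite gt_eqF.
have [Wu _] := u_sol; have [mu u_off _] := Wu.
have Eu := weak_solution_energy hp hq u_sol.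
have eu := W0_energy_lty hp hs Wu.
set Q := (\int[lebesgue_measure_rV N]_(x in Omega) (`|u x| `^ q)%:E)%E in Eu *.
have Q0 : (0 <= Q)%E by apply: integral_ge0 => x _; rewrite lee_fin powR_ge0.
have mq (f : 'rV[R]_N -> R) : measurable_fun setT f -> measurable_fun Omega (fun x => (`|f x| `^ q)%:E).
  move=> mf; apply: measurable_funTS; apply/measurable_EFinP.
  exact: measurable_norm_powR.
have Qneq0 : Q != 0%E.
  apply/eqP => QE; apply: u_nontrivial.
  have : (\int[lebesgue_measure_rV N]_(x in Omega) `|(`|u x| `^ q)%:E| = 0)%E.
    by rewrite -QE; apply: eq_integral => x _; rewrite gee0_abs ?lee_fin ?powR_ge0.
  move/(ae_eq_integral_abs _ mO (mq u mu)) => uq.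
  apply: (filterS2 _ _ uq u_off) => x ux nx.
  have [Ox|/nx//] := pselect (Omega x).
  by have [/powR_eq0_eq0/normr0_eq0] := ux Ox.
(* Integrability of [|u|^q] is read off the identity [Eu]: the energy is finite and [lambda] is
   positive. *)
have Qfin : Q \is a fin_num.
  rewrite ge0_fin_numE//; apply: contraTT eu; rewrite -!leNgt !leye_eq => /eqP QE.
  by rewrite Eu QE gt0_muley ?lte_fin.
have [r r0 QE] : exists2 r, 0 < r & Q = r%:E.
  by exists (fine Q); rewrite ?fineK// fine_gt0// lt0e Qneq0 Q0/= -ge0_fin_numE.
have tE : fine (Lqnorm q Omega u) = r `^ q^-1 by rewrite LqnormE// -/Q QE.
set t := r `^ q^-1 in tE.
have t0 : 0 < t by rewrite powR_gt0.
have tq : t `^ q = r by rewrite -powRrM mulVf// powRr1// ltW.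
have vE : (fun x => u x * (fine (Lqnorm q Omega u))^-1) = (fun x => t^-1 * u x).
  by apply/funext => x; rewrite tE mulrC.
rewrite {}vE.
(* The energy scales by [t^(-p) = r^(- p / q)], and [1 - p / q = (q - p) / q]. *)
have Ev : energy s p (fun x => t^-1 * u x) = (lambda * r `^ ((q - p) / q))%:E.
  rewrite energyZ// Eu QE -!EFinM gtr0_norm ?invr_gt0//; congr EFin.
  rewrite -powR_inv1 ?ltW// -!powRrM mulrCA; congr (_ * _).
  rewrite -[X in _ * X]powRr1 ?(ltW r0)// -powRD_gt0//; congr (_ `^ _).
  by field.
have adm : admissible s p q Omega (fun x => t^-1 * u x).
  split; first exact: W0Z.
  rewrite LqnormE// integral_powZ// -/Q QE -EFinM gtr0_norm ?invr_gt0//.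
  rewrite -tq -powRM ?invr_ge0 ?(ltW t0)// mulVf ?gt_eqF// powR1.
  by rewrite poweR_EFin powR1.
have lower w : admissible s p q Omega w ->
    (energy s p (fun x => (t^-1 * u x)%R) <= energy s p w)%E.
  move=> [Ww w1]; have mw : measurable_fun setT w by case: Ww.
  have wq : (\int[lebesgue_measure_rV N]_(x in Omega) (`|w x| `^ q)%:E = 1)%E.
    have := w1; rewrite LqnormE//; set I := (\int[_]_(x in _) _)%E => Iq.
    have I0 : (0 <= I)%E by apply: integral_ge0 => x _; rewrite lee_fin powR_ge0.
    have <- : (I `^ (q^-1 * q) = I)%E by rewrite mulVf// poweRe1.
    by rewrite poweRrM Iq poweR_EFin powR1.
  have := key_inequality mO nO hp hs hq hlambda u_nontrivial u_ge0 u_sol (W0Z t p0 Ww).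
  rewrite (integral_powZ q t mO mw) wq mule1 (gtr0_norm t0) tq (energyZ s t p0 mw) (gtr0_norm t0).
  have ew : energy s p w \is a fin_num.
    by rewrite ge0_fin_numE; [exact: W0_energy_lty Ww|exact: energy_ge0].
  rewrite (energyZ s _ p0 mu) Eu QE -(fineK ew) -!EFinM -EFinD !lee_fin => key.
  have tp0 : 0 < t `^ p by rewrite powR_gt0.
  rewrite gtr0_norm ?invr_gt0// -powR_inv1 ?(ltW t0)// -powRrM mulN1r powRN.
  rewrite ler_pdivrMl//.
  have qp0 : 0 < q / p by rewrite divr_gt0.
  (* The inequality [key], taken at [t * w], bounds [lambda * r] by [q / p] times the energy of
     [t * w] plus [(1 - q / p) * (lambda * r)]. Moving the last term to the left leaves the goal
     multiplied by [q / p]. *)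
  rewrite -(ler_pM2l qp0); nra.
have lamE : lambda_spq s p q Omega = energy s p (fun x => t^-1 * u x).
  apply/eqP; rewrite eq_le; apply/andP; split.
    apply: ereal_inf_lbound; exists (fun x => t^-1 * u x) => //.
    by rewrite -energy_Wnorm.
  by apply: le_ereal_inf_tmp => _ [w aw <-]; rewrite -(energy_Wnorm s w p0); exact: lower.
split; first by rewrite lamE Ev QE poweR_EFin.
by split => //; rewrite -energy_Wnorm.
Qed.
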